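(* Assume that $H$ is coercive, i.e. $\lim_{|p|\to\infty}\min_{x\in\mathbb T^n}H_i(x,p)=\infty$ for every $i\in\mathbb I$, and that for every $x\in\mathbb T^n$ the matrix $B(x)$ is monotone and irreducible. Then there exist $c^0\in\mathbb R$ and $v^0=(v^0_i)_{i\in\mathbb I}\in\operatorname{Lip}(\mathbb T^n)^m$ such that the pair $(c^0\mathbf 1,v^0)$ is a solution of the ergodic problem, i.e. $v^0$ is a solution of $Bv^0+H[v^0]=c^0\mathbf 1$ in $\mathbb T^n$.
   Context: Let $m,n\in\mathbb N$, $\mathbb I=\{1,\dots,m\}$, let $\mathbb T^n$ be the $n$-dimensional flat torus, $\Xi$ a (nonempty) compact metric space, $g=(g_i)_{i\in\mathbb I}\in C(\mathbb T^n\times\Xi,\mathbb R^n)^m$ and $L=(L_i)_{i\in\mathbb I}\in C(\mathbb T^n\times\Xi)^m$. The Hamiltonian $H=(H_i)_{i\in\mathbb I}$ is given by $H_i(x,p)=\max_{\xi\in\Xi}[-g_i(x,\xi)\cdot p-L_i(x,\xi)]$ for $(x,p)\in\mathbb T^n\times\mathbb R^n$. Let $B=(b_{ij})_{i,j\in\mathbb I}\in C(\mathbb T^n)^{m\times m}$, acting by $(Bu)_i(x)=\sum_{j\in\mathbb I}b_{ij}(x)u_j(x)$. $H[u]$ stands for $(H_i(x,Du_i(x)))_{i\in\mathbb I}$, and $\mathbf 1=(1,\dots,1)\in\mathbb R^m$. Monotone matrix: a real $m\times m$ matrix $A$ is monotone if whenever $u\in\mathbb R^m$ and $u_k=\max_{i\in\mathbb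 I}u_i\ge0$, then $(Au)_k\ge0$. Irreducible matrix: $B(x)$ is irreducible if for any nonempty $I\subsetneq\mathbb I$ there exist $i\in I$ and $j\in\mathbb I\setminus I$ with $b_{ij}(x)\ne0$. Solutions are viscosity solutions: for $c\in\mathbb R^m$, $u\in C(\mathbb T^n)^m$ is a subsolution (resp. supersolution) of $Bu+H[u]=c$ in $\mathbb T^n$ if for every $i\in\mathbb I$, $\psi\in C^1(\mathbb T^n)$ and every maximum (resp. minimum) point $x$ of $u_i-\psi$, one has $(Bu)_i(x)+H_i(x,D\psi(x))\le c_i$ (resp. $\ge c_i$); a solution is both. $\operatorname{Lip}(\mathbb T^n)$ is the set of Lipschitz continuous real functions on $\mathbb T^n$. *)

(* Defs.v *)
From HB Require Import structures.
From mathcomp Require Import all_boot all_order all_algebra.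
From mathcomp Require Import all_classical all_reals all_analysis.

Set Implicit Arguments.
Unset Strict Implicit.
Unset Printing Implicit Defensive.

Import Order.TTheory GRing.Theory Num.Theory.
Import numFieldNormedType.Exports.

Local Open Scope classical_set_scope.
Local Open Scope ring_scope.

(* The flat torus is R^n / Z^n, and functions on it are identified with
   Z^n-periodic functions on R^n; continuity, C^1 regularity, Lipschitz
   continuity, suprema and extremal points are unaffected by this
   identification.  The norm of 'rV[R]_n is the sup norm, which is equivalent
   to the Euclidean one; it is only used for the Lipschitz property and for the
   limit |p| -> oo. *)
Definition Zperiodic (R : realType) (n : nat) (T : Type)
    (f : 'rV[R]_n -> T) : Prop :=
  forall (x : 'rV[R]_n) (k : 'rV[int]_n), f (x + map_mx intr k) = f x.

Definition torus_continuous (R : realType) (n : nat) (f : 'rV[R]_n -> R)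
    : Prop :=
  continuous f /\ Zperiodic f.

Definition torus_lipschitz (R : realType) (n : nat) (f : 'rV[R]_n -> R)
    : Prop :=
  lipschitz f /\ Zperiodic f.

Definition grad (R : realType) (n : nat) (f : 'rV[R]_n -> R) (x : 'rV[R]_n)
    : 'rV[R]_n :=
  \row_k 'd f x (delta_mx 0 k).

Definition torus_C1 (R : realType) (n : nat) (f : 'rV[R]_n -> R) : Prop :=
  [/\ forall x, differentiable f x, continuous (grad f) & Zperiodic f].

Definition torus_prod_continuous (R : realType) (n : nat) (Xi : metricType R)
    (T : topologicalType) (f : 'rV[R]_n * Xi -> T) : Prop :=
  continuous f /\ forall xi, Zperiodic (fun x => f (x, xi)).

Definition dotp (R : realType) (n : nat) (p q : 'rV[R]_n) : R :=
  \sum_k p 0 k * q 0 k.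

(* When Xi is compact and nonempty and g_i, L_i are continuous, this supremum
   is a maximum. *)
Definition hamiltonian (R : realType) (m n : nat) (Xi : metricType R)
    (g : 'I_m -> 'rV[R]_n * Xi -> 'rV[R]_n) (L : 'I_m -> 'rV[R]_n * Xi -> R)
    (i : 'I_m) (x p : 'rV[R]_n) : R :=
  sup [set - dotp (g i (x, xi)) p - L i (x, xi) | xi in [set: Xi]].

(* The filter |p| -> oo on R^n. *)
Definition norm_infty (R : realType) (n : nat) : set_system 'rV[R]_n :=
  filter_from [set: R] (fun r => [set p | r < `|p|]).

(* The infimum over x is a minimum when H i is continuous and periodic in x. *)
Definition coercive (R : realType) (m n : nat)
    (H : 'I_m -> 'rV[R]_n -> 'rV[R]_n -> R) : Prop :=
  forall i : 'I_m,
    (fun p => inf [set H i x p | x in [set: 'rV[R]_n]]) @ @norm_infty R n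
      --> +oo.

Definition monotone_mx (R : realType) (m : nat) (A : 'M[R]_m) : Prop :=
  forall (u : 'cV[R]_m) (k : 'I_m),
    (forall i, u i 0 <= u k 0) -> 0 <= u k 0 -> 0 <= (A *m u) k 0.

Definition irreducible_mx (R : realType) (m : nat) (A : 'M[R]_m) : Prop :=
  forall I : {set 'I_m}, I != finset.set0 -> I \proper [set: 'I_m]%SET ->
    exists i j : 'I_m, [/\ i \in I, j \notin I & A i j != 0].

Definition coupling (R : realType) (m n : nat) (B : 'rV[R]_n -> 'M[R]_m)
    (u : 'I_m -> 'rV[R]_n -> R) (i : 'I_m) (x : 'rV[R]_n) : R :=
  \sum_j B x i j * u j x.

Definition maximum_point (R : realType) (n : nat) (f : 'rV[R]_n -> R)
    (x : 'rV[R]_n) : Prop :=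
  forall y, f y <= f x.

Definition minimum_point (R : realType) (n : nat) (f : 'rV[R]_n -> R)
    (x : 'rV[R]_n) : Prop :=
  forall y, f x <= f y.

Definition viscosity_subsolution (R : realType) (m n : nat)
    (B : 'rV[R]_n -> 'M[R]_m) (H : 'I_m -> 'rV[R]_n -> 'rV[R]_n -> R)
    (c : 'I_m -> R) (u : 'I_m -> 'rV[R]_n -> R) : Prop :=
  (forall i, torus_continuous (u i)) /\
  forall (i : 'I_m) (psi : 'rV[R]_n -> R) (x : 'rV[R]_n),
    torus_C1 psi -> maximum_point (fun y => u i y - psi y) x ->
    coupling B u i x + H i x (grad psi x) <= c i.

Definition viscosity_supersolution (R : realType) (m n : nat)
    (B : 'rV[R]_n -> 'M[R]_m) (H : 'I_m -> 'rV[R]_n -> 'rV[R]_n -> R)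
    (c : 'I_m -> R) (u : 'I_m -> 'rV[R]_n -> R) : Prop :=
  (forall i, torus_continuous (u i)) /\
  forall (i : 'I_m) (psi : 'rV[R]_n -> R) (x : 'rV[R]_n),
    torus_C1 psi -> minimum_point (fun y => u i y - psi y) x ->
    c i <= coupling B u i x + H i x (grad psi x).

Definition viscosity_solution (R : realType) (m n : nat)
    (B : 'rV[R]_n -> 'M[R]_m) (H : 'I_m -> 'rV[R]_n -> 'rV[R]_n -> R)
    (c : 'I_m -> R) (u : 'I_m -> 'rV[R]_n -> R) : Prop :=
  viscosity_subsolution B H c u /\ viscosity_supersolution B H c u.

(* Main.v *)
Require Import Defs.
From HB Require Import structures.
From mathcomp Require Import all_boot all_order all_algebra.
From mathcomp Require Import all_classical all_reals all_analysis.
From mathcomp Require Import ring lra.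

Set Implicit Arguments.
Unset Strict Implicit.
Unset Printing Implicit Defensive.

Import Order.TTheory GRing.Theory Num.Theory.
Import numFieldNormedType.Exports.

Local Open Scope classical_set_scope.
Local Open Scope ring_scope.

(** The ergodic pair is obtained from nonnegative subsolutions of the discounted
    system, with coupling [B + a] for a constant [a >= 0].

    The estimates come first ([nonneg_subsolution_estimates]). The Hamiltonian is
    bounded below, so the coupling term of a subsolution [u] is bounded above
    wherever [u] is touched by a test function, hence everywhere by density
    ([touching_dense]). For [u >= 0] this is a system of linear inequalities
    [B u <= C] at each point; irreducibility, made uniform by compactness of the
    torus, then bounds the differences between the components of [u]
    ([spread_bound]). The coupling term is thus bounded below as well,
    coercivity bounds the gradients of the test functions that touch [u], and
    [u] is Lipschitz ([lipschitz_of_test_gradients]). All constants are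
    independent of [a].

    Perron's method ([perron]) then needs no comparison principle: as soon as
    nonnegative subsolutions have a common upper bound, their supremum is
    Lipschitz, it is a subsolution by [viscosity_stability], and it is a
    supersolution by the usual bump construction ([perron_bump]).

    Two cases remain. If a row sum of [B] is positive at some point, it bounds
    one component of every nonnegative subsolution there, hence all of them, and
    Perron's method applies with [a = 0] and any large constant
    ([solution_of_row_sum_gt0]). Otherwise all row sums vanish and the problem
    is invariant under adding constants. The discounted problems with [a > 0]
    are covered by the first case; their solutions, normalised to have minimum
    0, and their constants are bounded uniformly in [a]
    ([normalized_discounted_solution]), so they converge along an ultrafilter as
    [a] tends to 0 ([equilipschitz_limit]), and the limit solves the problem
    ([solution_stability]).

    Test functions must be periodic; all of them are built from one
    trigonometric function, [bump], which dominates a paraboloid near its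
    centre. *)

(** * Extrema on the torus *)

Section Torus.
Context {R : realType} {n : nat}.
Implicit Types (x y : 'rV[R]_n) (f : 'rV[R]_n -> R).

Lemma coord_le_norm x k : `|x 0 k| <= `|x|.
Proof.
rewrite [leRHS]/Num.norm /= mx_normrE; apply/bigmax_geP; right => /=.
by exists (0, k).
Qed.

Lemma norm_le_coord x e : 0 <= e -> (forall k, `|x 0 k| <= e) -> `|x| <= e.
Proof.
move=> e0 xe; rewrite [leLHS]/Num.norm /= mx_normrE.
by apply/bigmax_leP; split=> // -[i k] _ /=; rewrite ord1.
Qed.

Lemma compact_cball x r : compact [set y | `|y - x| <= r].
Proof.
apply: bounded_closed_compact.
  exists (`|x| + r); split; first exact: num_real.
  move=> M rM y /= yx; rewrite -(subrK x y) (le_trans (ler_normD _ _))//.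
  by rewrite addrC (le_trans _ (ltW rM))// lerD2l.
have nc : continuous (fun y : 'rV[R]_n => `|y - x|).
  by move=> y; exact: (cvg_norm (cvgB cvg_id (cvg_cst _))).
exact: (continuous_closedP _).1 nc [set s | s <= r] (@closed_le _ r).
Qed.

Lemma cball_max f x r : 0 <= r -> continuous f ->
  exists c, `|c - x| <= r /\ forall y, `|y - x| <= r -> f y <= f c.
Proof.
move=> r0 fc.
have x_ball : [set y | `|y - x| <= r] !=set0.
  by exists x; rewrite /= subrr normr0.
have [c] := compact_EVT_max x_ball (compact_cball (x := x) (r := r))
  (continuous_subspaceT fc).
by rewrite inE => cx cmax; exists c; split=> // y yx; apply: cmax; rewrite inE.
Qed.

Lemma torus_shift x x0 :
  exists k : 'rV[int]_n, `|x + map_mx intr k - x0| <= 1 / 2.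
Proof.
exists (\row_j - Num.floor (x 0 j - x0 0 j + 1 / 2)).
apply: norm_le_coord => [|j]; first by lra.
rewrite !mxE; set t := x 0 j - x0 0 j + 1 / 2.
have /andP[] := real_floor_itv (num_real t).
rewrite rmorphN rmorphD /= /t => a b; rewrite ler_norml; lra.
Qed.

Lemma torus_max f x0 : torus_continuous f ->
  exists x, `|x - x0| <= 1 / 2 /\ maximum_point f x.
Proof.
move=> [fc fp].
have [|c [cx0 cmax]] := @cball_max f x0 (1 / 2) _ fc; first by lra.
exists c; split=> // y.
by have [k /cmax] := torus_shift y x0; rewrite fp.
Qed.

Lemma torus_continuousN f :
  torus_continuous f -> torus_continuous (fun x => - f x).
Proof.
move=> [fc fp]; split=> [x|x k]; first exact: cvgN (fc x).
by rewrite fp.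
Qed.

Lemma torus_min f : torus_continuous f -> exists x, minimum_point f x.
Proof.
move=> /torus_continuousN /(torus_max 0)[x [_ xmax]].
by exists x => y; rewrite -lerN2 xmax.
Qed.

Lemma torus_bounded f : torus_continuous f -> exists M, forall x, `|f x| <= M.
Proof.
move=> fT; have [a [_ amax]] := torus_max 0 fT; have [b bmin] := torus_min fT.
exists (`|f a| + `|f b|) => x; rewrite ler_norml.
have := amax x; have := bmin x; have := ler_norm (f a).
have := ler_norm (- f b); rewrite normrN.
have := normr_ge0 (f a); have := normr_ge0 (f b); lra.
Qed.

End Torus.

(** * Trigonometric inequalities *)

Section Trigonometry.
Context {R : realType}.
Implicit Types t a C N : R.

Lemma sub_sin_le t : `|t - sin t| <= t ^+ 2.
Proof.
wlog t0 : t / 0 <= t => [hw|].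
  have [/hw//|t0] := leP 0 t.
  have := hw (- t); rewrite sinN sqrrN opprK addrC -normrN opprB => -> //.
  by rewrite oppr_ge0 ltW.
have [c cI] : exists2 c, c \in `[0, t] &
    (t - sin t) - (0 - sin 0) = (1 - cos c) * (t - 0).
  apply: (@MVT_segment _ (fun x => x - sin x) (fun x => 1 - cos x)) => //.
  apply: continuous_subspaceT => x; exact: (cvgB cvg_id (@continuous_sin R x)).
rewrite sin0 !subr0 => ->.
have c0 : 0 <= c by rewrite (itvP cI).
have ct : c <= t by rewrite (itvP cI).
have [d _] : exists2 d, d \in `[0, c] & cos c - cos 0 = - sin d * (c - 0).
  apply: (@MVT_segment _ cos (fun x => - sin x)) => //.
  exact: (continuous_subspaceT (@continuous_cos R)).
rewrite cos0 subr0 => cosE.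
have sd := sin_geN1 d; have sd1 := sin_le1 d; have c1 := cos_le1 c.
rewrite ger0_norm ?expr2; last by apply: mulr_ge0; rewrite ?subr_ge0.
by apply: ler_wpM2r => //; nra.
Qed.

Lemma cos_piquarter_sqr : cos (pi / 4 : R) ^+ 2 = 1 / 2.
Proof.
have := cos_mulr2n (pi / 4 : R).
have -> : pi / 4 *+ 2 = pi / 2 :> R by field.
by rewrite cos_pihalf -[X in _ = X - 1]mulr_natl => h; lra.
Qed.

(** Halving the angle keeps it below pi / 4, where both the cosine and the slope
    of the sine are at least the cosine of pi / 4, whose square is 1 / 2. *)
Lemma sin_ge_half t : 0 <= t <= pi / 2 -> t / 2 <= sin t.
Proof.
move=> /andP[t0 tpi]; have pi0 := pi_gt0 R.
have cq : 0 < cos (pi / 4 : R).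
  by apply: cos_gt0_pihalf; apply/andP; split; lra.
have cos_ge c : 0 <= c <= t / 2 -> cos (pi / 4) <= cos c.
  move=> /andP[c0 ct]; rewrite leNgt ltr_cos -?leNgt ?in_itv/=; first by lra.
    by apply/andP; split; lra.
  by apply/andP; split; lra.
have [d dI] : exists2 d, d \in `[0, t / 2] &
    sin (t / 2) - sin 0 = cos d * (t / 2 - 0).
  apply: (@MVT_segment _ sin cos) => //; first by lra.
  exact: (continuous_subspaceT (@continuous_sin R)).
rewrite sin0 !subr0 => sinE.
have := sin_mulr2n (t / 2); have -> : t / 2 *+ 2 = t by field.
move=> ->; rewrite sinE.
have h1 : cos (pi / 4) <= cos (t / 2) by apply: cos_ge; apply/andP; split; lra.
have h2 : cos (pi / 4) <= cos d by apply: cos_ge; rewrite !(itvP dI).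
have h3 : 1 / 2 <= cos (t / 2) * cos d.
  by rewrite -cos_piquarter_sqr expr2 ler_pM// ltW.
have := ler_wpM2r t0 h3; rewrite -mulr_natl; set c := cos _; set e := cos _; lra.
Qed.

Lemma sqr_le_oneBcos t : `|t| <= 1 / 2 ->
  t ^+ 2 <= (1 - cos (2 * pi * t)) / 2.
Proof.
wlog t0 : t / 0 <= t => [hw|].
  have [/hw//|t0] := leP 0 t.
  have := hw (- t); rewrite normrN sqrrN mulrN cosN; apply.
  by rewrite oppr_ge0 ltW.
rewrite ger0_norm// => t1; have pi2 := pi_ge2 R.
have -> : 2 * pi * t = (pi * t) *+ 2 by ring.
rewrite cos_mulr2n cos2sin2 -mulr_natl.
have pt : 2 * t <= pi * t by apply: ler_wpM2r.
have pt' : pi * t <= pi * (1 / 2) by apply: ler_wpM2l => //; exact: pi_ge0.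
have : t <= sin (pi * t).
  apply: (le_trans _ (sin_ge_half _)); first by lra.
  by apply/andP; split; lra.
by move=> h; rewrite (_ : _ / 2 = sin (pi * t) ^+ 2);
  [rewrite ler_pXn2r ?nnegrE//; lra | field].
Qed.

(** A periodic substitute for a parabola: it has value 0 and slope [a] at 0, and
    for large [N] it dominates [a * t + C * t ^+ 2] on the period centred at 0
    ([profile_ge]). *)
Definition profile a N t : R :=
  a / (2 * pi) * sin (2 * pi * t) + N * ((1 - cos (2 * pi * t)) / 2).

Definition dprofile a N t : R :=
  a * cos (2 * pi * t) + N * pi * sin (2 * pi * t).

Lemma is_derive_profile a N c t :
  is_derive t 1 (fun s => profile a N (s - c)) (dprofile a N (t - c)).
Proof.
have lin : is_derive t 1 (fun s => 2 * pi * (s - c)) (2 * pi).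
  rewrite (_ : (fun s => _) = (2 * pi) *: (id - cst c)); last first.
    by apply/funext => s; rewrite !fctE.
  by apply: is_derive_eq; rewrite subr0 /GRing.scale /= mulr1.
have dsin := is_derive1_comp (is_derive_sin _) lin.
have dcos := is_derive1_comp (is_derive_cos _) lin.
have pi0 : pi != 0 :> R by rewrite gt_eqF// pi_gt0.
have -> : (fun s => profile a N (s - c)) =
    ((a / (2 * pi)) *: (sin \o (fun s => 2 * pi * (s - c)))) +
    (N / 2) *: (cst 1 - (cos \o (fun s => 2 * pi * (s - c)))).
  apply/funext => s; rewrite /profile /= !fctE /GRing.scale /=.
  by ring.
have := is_deriveD (is_deriveZ (a / (2 * pi)) dsin)
  (is_deriveZ (N / 2) (is_deriveB (is_derive_cst (1 : R^o) t 1) dcos)).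
move=> /is_derive_eq; apply; rewrite /dprofile /GRing.scale /=.
by move: (cos _) (sin _) => C S; move: (@pi R) pi0 => p p0; field.
Qed.

Lemma profile_periodic a N t (k : int) : profile a N (t + k%:~R) = profile a N t.
Proof.
have per (f : R -> R) : periodic f (pi *+ 2) ->
    f (2 * pi * (t + k%:~R)) = f (2 * pi * t).
  have step (j : nat) : pi *+ 2 *+ j = 2 * pi * j%:R.
    by rewrite -[LHS]mulr_natr -[pi *+ 2]mulr_natl.
  move=> fp; case: k => k.
    rewrite -[RHS](periodicn fp k); congr (f _).
    by rewrite step -pmulrn mulrDr.
  rewrite -(periodicn fp k.+1); congr (f _).
  by rewrite step NegzE mulrNz -pmulrn mulrDr mulrN subrK.
by rewrite /profile !per//; [exact: cosD2pi | exact: sinD2pi].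
Qed.

Lemma profile_ge a C N t : 0 <= C -> C + 2 * pi * `|a| <= N -> `|t| <= 1 / 2 ->
  a * t + C * t ^+ 2 <= profile a N t.
Proof.
move=> C0 + t1; have := mulr_gt0 (ltr0Sn R 1) (pi_gt0 R).
have := sub_sin_le (2 * pi * t); have := sqr_le_oneBcos t1.
rewrite /profile; move: (2 * pi) => q h2 h1 q0 NC.
have h3 : a * t - a / q * sin (q * t) <= q * `|a| * t ^+ 2.
  have -> : a * t - a / q * sin (q * t) = a / q * (q * t - sin (q * t)).
    by field; rewrite gt_eqF.
  apply: (le_trans (ler_norm _)); rewrite normrM.
  apply: (le_trans (ler_wpM2l _ h1)) => //.
  rewrite normrM normfV (ger0_norm (ltW q0)).
  by rewrite le_eqVlt; apply/orP; left; apply/eqP; field; rewrite gt_eqF.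
have a0 := normr_ge0 a; have t20 := sqr_ge0 t.
have h4 : (C + q * `|a|) * t ^+ 2 <= N * ((1 - cos (q * t)) / 2).
  by apply: ler_pM => //; rewrite addr_ge0// mulr_ge0// ltW.
lra.
Qed.

Lemma profile0_ge0 t : 0 <= profile 0 1 t.
Proof.
by rewrite /profile mul0r mul0r add0r mul1r divr_ge0// subr_ge0 cos_le1.
Qed.

End Trigonometry.

(** * Periodic test functions *)

(** A directional derivative only sees the restriction to a line; this transfers
    derivatives between functions on different spaces. *)
Lemma derive_line {R : realType} {V V' W : normedModType R} (f : V -> W)
    (g : V' -> W) (x v : V) (y w : V') :
    (forall t : R, f (t *: v + x) = g (t *: w + y)) ->
  'D_v f x = 'D_w g y /\ (derivable f x v -> derivable g y w).
Proof.
move=> fg; have fxy : f x = g y by have := fg 0; rewrite !scale0r !add0r.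
rewrite /derive /derivable.
have -> : (fun h : R => h^-1 *: ((f \o shift x) (h *: v) - f x)) =
    (fun h => h^-1 *: ((g \o shift y) (h *: w) - g y)).
  by apply/funext => h; rewrite /= fg fxy.
by [].
Qed.

Lemma row_continuous {R : realType} {n : nat} (T : topologicalType)
    (F : T -> 'rV[R]_n) :
  (forall k, continuous (fun t => F t 0 k)) -> continuous F.
Proof.
move=> Fc t; apply/cvg_ballP => e e0.
have : \forall s \near t, forall k, ball (F t 0 k) e (F s 0 k).
  by apply: filter_forall => k; apply: (cvg_ball (Fc k t)).
by apply: filterS => s Fs; split=> // i j; rewrite ord1; exact: Fs.
Qed.

Section TestFunctions.
Context {R : realType} {n : nat}.
Implicit Types (x y p : 'rV[R]_n) (f g psi : 'rV[R]_n -> R).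

Lemma gradE f x i k : differentiable f x ->
  grad f x i k = 'D_(delta_mx 0 k) f x.
Proof. by move=> fx; rewrite mxE deriveE. Qed.

Lemma torus_C1_continuous f : torus_C1 f -> torus_continuous f.
Proof.
by move=> [fd _ fp]; split=> // x; exact/differentiable_continuous/fd.
Qed.

Lemma torus_C1_cst (a : R) : torus_C1 (fun _ : 'rV[R]_n => a).
Proof.
split=> //.
rewrite (_ : grad _ = cst 0); first exact: cst_continuous.
by apply/funext => x; apply/rowP => k; rewrite !mxE diff_cst.
Qed.

Lemma gradD f g x : differentiable f x -> differentiable g x ->
  grad (fun y => f y + g y) x = grad f x + grad g x.
Proof. by move=> fx gx; apply/rowP => k; rewrite !mxE diffD. Qed.

Lemma gradN f x : differentiable f x -> grad (fun y => - f y) x = - grad f x.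
Proof. by move=> fx; apply/rowP => k; rewrite !mxE diffN. Qed.

Lemma grad_cst (a : R) x : grad (fun _ => a) x = 0.
Proof. by apply/rowP => k; rewrite !mxE diff_cst. Qed.

Lemma torus_C1D f g : torus_C1 f -> torus_C1 g -> torus_C1 (fun y => f y + g y).
Proof.
move=> [fd fc fp] [gd gc gp]; split=> [x||x k].
- exact: differentiableD.
- rewrite (_ : grad _ = fun x => grad f x + grad g x).
    by move=> x; exact: (cvgD (fc x) (gc x)).
  by apply/funext => x; exact: gradD.
- by rewrite fp gp.
Qed.

Lemma torus_C1N f : torus_C1 f -> torus_C1 (fun y => - f y).
Proof.
move=> [fd fc fp]; split=> [x||x k].
- exact: differentiableN.
- rewrite (_ : grad _ = fun x => - grad f x); first by move=> x; exact: cvgN (fc x).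
  by apply/funext => x; exact: gradN.
- by rewrite fp.
Qed.

Lemma grad_periodic f : torus_C1 f -> Zperiodic (grad f).
Proof.
move=> [fd _ fp] x k.
have fz e : f (e + (x + map_mx intr k)) = f (e + x) by rewrite addrA fp.
move: (x + map_mx intr k) fz => z fz.
apply/rowP => j.
apply: etrans (gradE _ j (fd z)) (etrans _ (esym (gradE _ j (fd x)))).
by apply: (derive_line _).1 => t; rewrite fz.
Qed.

Lemma grad_eq_at_max f g x : torus_C1 f -> torus_C1 g ->
  maximum_point (fun y => f y - g y) x -> grad f x = grad g x.
Proof.
move=> fC gC xmax; pose h y := f y - g y.
have [hd _ _] : torus_C1 h by apply: torus_C1D => //; exact: torus_C1N.
have [fd _ _] := fC; have [gd _ _] := gC.
apply/eqP; rewrite -subr_eq0 -gradN// -gradD//; last exact: differentiableN.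
apply/eqP/rowP => k; rewrite -/h gradE// mxE.
pose e : 'rV[R]_n := delta_mx 0 k; pose l (t : R) := h (t *: e + x).
have ld t : 'D_e h (t *: e + x) = 'D_1 l t /\
    (derivable h (t *: e + x) e -> derivable l t 1).
  apply: derive_line => s; rewrite /l; congr h.
  by rewrite addrA -scalerDl [s *: (1 : R)]mulr1.
have [] : is_derive (0 : R) 1 l 0.
  apply: (@derive1_at_max R l (-1) 1) => [|t _||t _].
  - lra.
  - exact/(ld t).2/diff_derivable.
  - by rewrite in_itv/=; apply/andP; split; lra.
  - by rewrite /l scale0r add0r; exact: xmax.
by move=> _; rewrite -(ld 0).1 scale0r add0r.
Qed.

Definition bump x p (N : R) y : R := \sum_k profile (p 0 k) N (y 0 k - x 0 k).

Lemma bump_grad x p N y : differentiable (bump x p N) y /\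
  grad (bump x p N) y = \row_k dprofile (p 0 k) N (y 0 k - x 0 k).
Proof.
pose h k z := profile (p 0 k) N ((z : 'rV[R]_n) 0 k - x 0 k).
have -> : bump x p N = \sum_k h k by apply/funext => z; rewrite fct_sumE.
have hd k z : differentiable (h k) z.
  apply: (@differentiable_comp _ _ _ _ (fun z : 'rV[R]_n => z 0 k)
    (fun s => profile (p 0 k) N (s - x 0 k))); first exact: differentiable_coord.
  by apply/derivable1_diffP; have [] := is_derive_profile (p 0 k) N (x 0 k) (z 0 k).
have sd : differentiable (\sum_k h k) y by apply: differentiable_sum.
split=> //; apply/rowP => j; rewrite gradE// mxE derive_sum; last first.
  by move=> k; exact: diff_derivable.
rewrite (bigD1 j)//= big1 ?addr0 => [|k kj].
  have [_ <-] := is_derive_profile (p 0 j) N (x 0 j) (y 0 j).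
  apply: (derive_line _).1 => s.
  by rewrite /h !mxE !eqxx mulr1 [s *: (1 : R)]mulr1.
rewrite -[RHS](derive_cst (h k y) y (delta_mx 0 j)).
apply: (derive_line _).1 => s.
by rewrite /h !mxE (negbTE kj) andbF mulr0 add0r.
Qed.

Lemma bump_C1 x p N : torus_C1 (bump x p N).
Proof.
split=> [y||y k]; first exact: (bump_grad x p N y).1.
  rewrite (_ : grad _ = fun y => \row_k dprofile (p 0 k) N (y 0 k - x 0 k)); last first.
    by apply/funext => y; exact: (bump_grad x p N y).2.
  apply: row_continuous => k y.
  have cF : continuous (fun s => dprofile (p 0 k) N (s - x 0 k)).
    move=> s; have lc : 2 * pi * (t - x 0 k) @[t --> s] --> 2 * pi * (s - x 0 k).
      exact: cvgM (cvg_cst _) (cvgB cvg_id (cvg_cst _)).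
    apply: cvgD; apply: cvgM; try exact: cvg_cst.
      exact: (cvg_comp _ _ lc (@continuous_cos R _)).
    exact: (cvg_comp _ _ lc (@continuous_sin R _)).
  rewrite (_ : (fun t => _) = (fun s => dprofile (p 0 k) N (s - x 0 k)) \o
      (fun z : 'rV[R]_n => z 0 k)); last by apply/funext => z; rewrite /= mxE.
  by apply: continuous_comp; [exact: coord_continuous | exact: cF].
by apply: eq_bigr => j _; rewrite !mxE addrAC profile_periodic.
Qed.

Lemma bump_center x p N : bump x p N x = 0.
Proof.
rewrite /bump big1// => k _.
by rewrite /profile subrr mulr0 sin0 cos0 subrr mul0r !mulr0 addr0.
Qed.

Lemma grad_bump_center x p N : grad (bump x p N) x = p.
Proof.
rewrite (bump_grad x p N x).2; apply/rowP => k.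
by rewrite mxE /dprofile subrr mulr0 sin0 cos0 mulr0 addr0 mulr1.
Qed.

Lemma bump_ge x p (C N : R) y : 0 <= C ->
  (forall k, C + 2 * pi * `|p 0 k| <= N) -> `|y - x| <= 1 / 2 ->
  dotp p (y - x) + C * dotp (y - x) (y - x) <= bump x p N y.
Proof.
move=> C0 NC yx; rewrite /dotp mulr_sumr -big_split /=; apply: ler_sum => k _.
have := coord_le_norm (y - x) k; rewrite !mxE -expr2 => h.
by apply: profile_ge => //; exact: le_trans yx.
Qed.

Lemma dotp_ge_norm x : `|x| ^+ 2 <= dotp x x.
Proof.
have d0 : 0 <= dotp x x by apply: sumr_ge0 => k _; rewrite -expr2 sqr_ge0.
rewrite -[leRHS]sqr_sqrtr// ler_pXn2r ?nnegrE ?sqrtr_ge0//.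
apply: norm_le_coord => [|k]; first exact: sqrtr_ge0.
rewrite -sqrtr_sqr ler_wsqrtr// /dotp (bigD1 k)//= expr2 lerDl.
by apply: sumr_ge0 => j _; rewrite -expr2 sqr_ge0.
Qed.

Lemma bump0_ge0 x y : 0 <= bump x 0 1 y.
Proof. by apply: sumr_ge0 => k _; rewrite mxE profile0_ge0. Qed.

Lemma bump0_ge N x y : 0 <= N -> `|y - x| <= 1 / 2 ->
  N * `|y - x| ^+ 2 <= bump x 0 N y.
Proof.
move=> N0 yx; apply: (le_trans (ler_wpM2l N0 (dotp_ge_norm _))).
have := @bump_ge x 0 N N y N0.
have -> : dotp 0 (y - x) = 0 by rewrite /dotp big1// => k _; rewrite mxE mul0r.
by rewrite add0r; apply => // k; rewrite mxE normr0 mulr0 addr0.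
Qed.

(** Test functions have to be periodic, but a paraboloid that touches [f] from
    above globally may replace them: on the unit cube around [x] it lies below a
    bump with the same slope, and periodicity takes care of the rest. *)
Lemma paraboloid_test f x p C : Zperiodic f -> 0 <= C ->
  (forall y, f y <= f x + dotp p (y - x) + C * dotp (y - x) (y - x)) ->
  exists psi, [/\ torus_C1 psi, maximum_point (fun y => f y - psi y) x &
    grad psi x = p].
Proof.
move=> fp C0 fpar; pose N := C + 2 * pi * `|p|.
have pi0 := pi_gt0 R.
exists (bump x p N); split; [exact: bump_C1 | move=> y | exact: grad_bump_center].
have [k yk] := torus_shift y x.
have [_ _ bp] := bump_C1 x p N; rewrite -(bp y k) -(fp y k) bump_center subr0.
have := fpar (y + map_mx intr k); move: (y + _) yk => z zx fz.
have := @bump_ge x p C N z C0 _ zx; rewrite -/N => h.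
suff : dotp p (z - x) + C * dotp (z - x) (z - x) <= bump x p N z by lra.
apply: h => j; rewrite /N lerD2l ler_wpM2l ?coord_le_norm//.
by rewrite mulr_ge0// ltW.
Qed.

End TestFunctions.

(** * Stability and regularity of a scalar function *)

Section Scalar.
Context {R : realType} {n : nat}.
Implicit Types (x y z p : 'rV[R]_n) (u psi : 'rV[R]_n -> R).

Lemma near_ball (P : 'rV[R]_n -> Prop) x : (\forall y \near x, P y) ->
  exists2 d : R, 0 < d & forall y, `|y - x| < d -> P y.
Proof.
move=> /nbhs_ballP[d d0 dP]; exists d => // y yx; apply: dP.
by rewrite -ball_normE /ball_ /= distrC.
Qed.

Lemma continuous_pos (G : 'rV[R]_n -> R) x (a : R) : {for x, continuous G} ->
  a < G x -> \forall y \near x, a < G y.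
Proof. by move=> Gc aG; apply: (cvgr_gt (G x) Gc). Qed.

Lemma continuous_dist (G : 'rV[R]_n -> R) x (a : R) : {for x, continuous G} ->
  0 < a -> \forall y \near x, `|G y - G x| < a.
Proof.
move=> Gc a0; have /cvgrPdist_lt/(_ _ a0) := Gc.
by apply: filterS => y; rewrite distrC.
Qed.

(** Stability of the test [F x (grad psi x) <= 0] under approximation of [u] by
    functions [w] that are nearly below [u] everywhere and nearly equal to it at
    [x]. Adding to [psi] a bump centred at [x] makes the contact strict, so the
    contact points of [w] converge to [x]. The one-sided form serves both
    suprema and uniform limits. *)
Lemma viscosity_stability u psi x (F : 'rV[R]_n -> 'rV[R]_n -> R) :
  torus_continuous u -> torus_C1 psi -> maximum_point (fun y => u y - psi y) x ->
  continuous (fun z : 'rV[R]_n * 'rV[R]_n => F z.1 z.2) ->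
  (forall e, 0 < e -> exists2 r, 0 < r & forall d, 0 < d ->
    exists w, [/\ torus_continuous w, forall y, w y <= u y + d, u x - d <= w x &
      forall phi y, torus_C1 phi -> maximum_point (fun z => w z - phi z) y ->
        `|w y - u y| <= r -> F y (grad phi y) <= e]) ->
  F x (grad psi x) <= 0.
Proof.
move=> uT psiC xmax Fc approx; rewrite leNgt; apply/negP => F0.
have [r r0 {}approx] := approx (F x (grad psi x) / 2) (divr_gt0 F0 (ltr0Sn _ 1)).
pose phi y := psi y + bump x 0 1 y.
have bC := bump_C1 x 0 (1 : R).
have phiC : torus_C1 phi by apply: torus_C1D.
have phix : grad phi x = grad psi x.
  have [pd _ _] := psiC; have [bd _ _] := bC.
  by rewrite gradD// grad_bump_center addr0.
have [_ gc _] := phiC.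
have r3 : 0 < r / 3 by rewrite divr_gt0.
have Gc : {for x, continuous (fun y => F y (grad phi y))}.
  apply: (@continuous_comp _ _ _ (fun y => (y, grad phi y))
      (fun z : 'rV[R]_n * 'rV[R]_n => F z.1 z.2)).
    exact: (cvg_pair cvg_id (gc x)).
  exact: Fc.
have G0 : F x (grad psi x) / 2 < F x (grad phi x) by rewrite phix; lra.
have [d d0 dP] : exists2 d : R, 0 < d & forall y, `|y - x| < d ->
    [/\ F x (grad psi x) / 2 < F y (grad phi y), `|u y - u x| < r / 3 &
      `|psi y - psi x| < r / 3].
  apply: near_ball.
  have h1 := continuous_pos Gc G0.
  have h2 := continuous_dist (uT.1 x) r3.
  have h3 := continuous_dist ((torus_C1_continuous psiC).1 x) r3.
  by near=> y; split; near: y.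
(* The contact point [y] of [w] satisfies |y - x|^2 <= 2 a < d^2. *)
pose a := Num.min (r / 3) (d ^+ 2 / 3).
have d2 : 0 < d ^+ 2 / 3 by rewrite divr_gt0// exprn_gt0.
have a0 : 0 < a by rewrite lt_min r3 d2.
have ar : a <= r / 3 by rewrite ge_min lexx.
have ad : a <= d ^+ 2 / 3 by rewrite ge_min lexx orbT.
have [w [wT wu wx wF]] := approx a a0.
have [|y [yx ymax]] := @torus_max _ _ (fun z => w z - phi z) x.
  have [c1 p1] := torus_continuousN (torus_C1_continuous phiC).
  by split=> [z|z k]; [exact: (cvgD (wT.1 z) (c1 z)) | rewrite wT.2 p1].
have h1 : w x - psi x <= w y - (psi y + bump x 0 1 y).
  by have := ymax x; rewrite /phi bump_center addr0.
have h2 : u y - psi y <= u x - psi x := xmax y.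
have h3 := wu y.
have h4 := bump0_ge ler01 yx; have h5 := bump0_ge0 x y.
rewrite mul1r in h4.
have yd : `|y - x| < d.
  rewrite -(ltr_pXn2r (n := 2))// ?nnegrE ?(ltW d0)//.
  apply: (le_lt_trans h4).
  move: h1 h2 h3 wx ad d2; move: (bump _ _ _ _) (u y) (u x) (w y) (w x).
  by move: (psi x) (psi y) (a) (d ^+ 2); clear=> *; lra.
have [h6 h7 h8] := dP y yd.
have wr : `|w y - u y| <= r.
  rewrite ler_norml; move: h1 h2 h3 h5 h7 h8 wx a0 ar; rewrite !ltr_norml.
  move: (bump _ _ _ _) (u y) (u x) (w y) (w x) (psi x) (psi y) (a).
  clear=> ? ? ? ? ? ? ? ? ? ? ? ? /andP[? ?] /andP[? ?] ? ? ?.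
  by apply/andP; split; lra.
by have := wF _ _ phiC ymax wr; rewrite leNgt h6.
Unshelve. all: by end_near. Qed.

(** Points where a continuous function is touched from above are dense: steep
    bumps centred at [x] touch it near [x]. *)
Lemma touching_dense u (G : 'rV[R]_n -> R) :
  torus_continuous u -> continuous G ->
  (forall psi y, torus_C1 psi -> maximum_point (fun z => u z - psi z) y ->
    G y <= 0) ->
  forall x, G x <= 0.
Proof.
move=> uT Gc Gt x; rewrite leNgt; apply/negP => G0.
have [d d0 dP] := near_ball (continuous_pos (Gc x) G0).
have [M uM] := torus_bounded uT.
pose N := (2 * M + 1) / d ^+ 2.
have M0 : 0 <= M by apply: le_trans (uM x).
have d20 : 0 < d ^+ 2 by rewrite exprn_gt0.
have N0 : 0 < N by rewrite divr_gt0//; lra.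
have bC := bump_C1 x 0 N.
have [|y [yx ymax]] := @torus_max _ _ (fun z => u z - bump x 0 N z) x.
  have [c1 p1] := torus_continuousN (torus_C1_continuous bC).
  by split=> [z|z k]; [exact: (cvgD (uT.1 z) (c1 z)) | rewrite uT.2 p1].
have := Gt _ _ bC ymax; rewrite leNgt dP//.
have := ymax x; rewrite bump_center subr0 => h1.
have h4 := bump0_ge (ltW N0) yx.
rewrite -(ltr_pXn2r (n := 2))// ?nnegrE ?(ltW d0)//.
rewrite -(ltr_pM2l N0) [X in _ < X](_ : _ = 2 * M + 1); last first.
  by rewrite /N divfK// gt_eqF.
have := uM x; have := uM y; rewrite !ler_norml => /andP[? ?] /andP[? ?]; lra.
Qed.

Lemma sum_continuous (T : topologicalType) (I : finType) (P : pred I)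
    (f : I -> T -> R) t :
  (forall k, {for t, continuous (f k)}) ->
  {for t, continuous (fun s => \sum_(k | P k) f k s)}.
Proof. by move=> fc; apply: cvg_big => [|k _]; [exact: add_continuous | exact: fc]. Qed.

Lemma dotp_continuous (T : topologicalType) (f g : T -> 'rV[R]_n) t :
  {for t, continuous f} -> {for t, continuous g} ->
  {for t, continuous (fun s => dotp (f s) (g s))}.
Proof.
move=> fc gc; rewrite /dotp; apply: sum_continuous => k.
have cc (h : T -> 'rV[R]_n) : {for t, continuous h} ->
    {for t, continuous (fun s => h s 0 k)}.
  move=> hc.
  apply: (@continuous_comp _ _ _ h (fun v : 'rV[R]_n => v 0 k) t hc).
  exact: coord_continuous.
exact: (cvgM (cc f fc) (cc g gc)).
Qed.

Definition enorm x := Num.sqrt (dotp x x).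

Lemma dotp_ge0 x : 0 <= dotp x x.
Proof. by apply: sumr_ge0 => k _; rewrite -expr2 sqr_ge0. Qed.

Lemma enorm_sqr x : enorm x ^+ 2 = dotp x x.
Proof. by rewrite sqr_sqrtr// dotp_ge0. Qed.

Lemma norm_le_enorm x : `|x| <= enorm x.
Proof.
by rewrite -(ler_pXn2r (n := 2))// ?nnegrE ?sqrtr_ge0// enorm_sqr dotp_ge_norm.
Qed.

Lemma enorm_le_norm x : enorm x <= n%:R * `|x|.
Proof.
rewrite -(ler_pXn2r (n := 2))// ?nnegrE ?sqrtr_ge0 ?mulr_ge0// enorm_sqr.
rewrite (@le_trans _ _ (n%:R * `|x| ^+ 2))//; last first.
  rewrite exprMn ler_wpM2r ?sqr_ge0// -natrX ler_nat.
  by case: (n) => // m; rewrite expnS expn1 leq_pmulr.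
rewrite /dotp mulr_natl -[X in _ *+ X]card_ord -sumr_const; apply: ler_sum => k _.
by rewrite -expr2 -real_normK ?num_real// ler_pXn2r ?nnegrE// coord_le_norm.
Qed.

(** A bound on the gradients of all test functions touching from above is a
    Lipschitz bound: otherwise a steep cone touches away from its vertex, and
    there the cone lies below a paraboloid with a large gradient. *)
Lemma lipschitz_of_test_gradients u (K : R) : torus_continuous u -> 0 <= K ->
  (forall psi y, torus_C1 psi -> maximum_point (fun z => u z - psi z) y ->
    `|grad psi y| <= K) ->
  forall x z, u z - u x <= (n%:R * K + 1) * n%:R * `|z - x|.
Proof.
move=> uT K0 Kt x; set A := n%:R * K + 1.
have A0 : 0 < A by rewrite ltr_wpDl// mulr_ge0.
have [M uM] := torus_bounded uT.
have M0 : 0 <= M by apply: le_trans (uM x).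
pose f z := u z - A * enorm (z - x).
have fc : continuous f.
  move=> z; have sc : {for z, continuous (fun y => y - x)}.
    exact: (cvgB cvg_id (cvg_cst _)).
  have ec : {for z, continuous (fun y => enorm (y - x))}.
    apply: (@continuous_comp _ _ _ (fun y => dotp (y - x) (y - x)) Num.sqrt).
      exact: dotp_continuous.
    exact: sqrt_continuous.
  exact: (cvgB (uT.1 z) (cvgM (cvg_cst A) ec)).
(* Beyond this radius the cone exceeds the oscillation of [u]. *)
have r0 : 0 <= 2 * M / A by rewrite divr_ge0 ?(ltW A0)// mulr_ge0.
have [c [cx cmax]] := cball_max x r0 fc.
have enorm0 : enorm (x - x) = 0.
  by rewrite /enorm subrr /dotp big1 ?sqrtr0// => k _; rewrite mxE mul0r.
have {}cmax z : f z <= f c.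
  have [/cmax//|zx] := leP `|z - x| (2 * M / A).
  have: f x <= f c by apply: cmax; rewrite subrr normr0.
  apply: le_trans; rewrite /f enorm0 mulr0 subr0.
  have : 2 * M <= A * enorm (z - x).
    have -> : 2 * M = A * (2 * M / A) by rewrite mulrCA divff ?mulr1// gt_eqF.
    by rewrite ler_pM2l// (le_trans (ltW zx))// norm_le_enorm.
  have := uM x; have := uM z; rewrite !ler_norml => /andP[? ?] /andP[? ?]; lra.
have [cxE|cNx] := eqVneq c x.
  move=> z; have := cmax z; rewrite /f cxE enorm0 mulr0 subr0.
  have := ler_wpM2l (ltW A0) (enorm_le_norm (z - x)); rewrite mulrA; lra.
exfalso; set rho := enorm (c - x).
have cx0 : 0 < `|c - x| by rewrite normr_gt0 subr_eq0.
have rho0 : 0 < rho by rewrite (lt_le_trans cx0)// norm_le_enorm.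
have [|z|psi [psiC psimax psigrad]] := @paraboloid_test _ _ u c
  ((A / rho) *: (c - x)) (A / (2 * rho)) uT.2.
- by rewrite divr_ge0 ?mulr_ge0// ltW.
- (* The cone lies below the paraboloid (|z - x|^2 + rho^2) / (2 rho), with
     equality at [c]. *)
  have zE : dotp (z - x) (z - x) = rho ^+ 2 + 2 * dotp (c - x) (z - c) +
      dotp (z - c) (z - c).
    rewrite /rho enorm_sqr /dotp mulr_sumr -!big_split /=.
    by apply: eq_bigr => k _; rewrite !mxE; ring.
  have amgm : enorm (z - x) - rho <= (dotp (z - x) (z - x) - rho ^+ 2) / (2 * rho).
    rewrite -enorm_sqr ler_pdivlMr ?mulr_gt0//.
    by have := sqr_ge0 (enorm (z - x) - rho); nra.
  have := cmax z; rewrite /f -/rho.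
  have -> : dotp ((A / rho) *: (c - x)) (z - c) = A / rho * dotp (c - x) (z - c).
    by rewrite /dotp mulr_sumr; apply: eq_bigr => k _; rewrite !mxE mulrA.
  have := ler_wpM2l (ltW A0) amgm; rewrite zE.
  have -> : A * ((rho ^+ 2 + 2 * dotp (c - x) (z - c) + dotp (z - c) (z - c) -
      rho ^+ 2) / (2 * rho)) = A / rho * dotp (c - x) (z - c) +
      A / (2 * rho) * dotp (z - c) (z - c).
    by field; rewrite gt_eqF.
  lra.
have Arho : 0 <= A / rho by rewrite divr_ge0// ltW.
have := enorm_le_norm (c - x); rewrite -/rho => rhon.
have := Kt psi c psiC psimax; rewrite psigrad normrZ (ger0_norm Arho).
rewrite mulrAC ler_pdivrMr// => h.
have : A * `|c - x| <= n%:R * K * `|c - x|.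
  by apply: (le_trans h); have := ler_wpM2l K0 rhon; rewrite mulrCA mulrA.
by rewrite ler_pM2r// /A gerDl ler10.
Qed.

End Scalar.

(** * Irreducible coupling matrices *)

Section Matrices.
Context {R : realType} {m : nat}.
Implicit Types (A : 'M[R]_m) (u : 'I_m -> R).

(** Monotonicity in terms of entries. Discounts and changes of a single component
    are then handled entry by entry. *)
Definition m_matrix A : Prop :=
  (forall i j, i != j -> A i j <= 0) /\ (forall i, 0 <= \sum_j A i j).

Lemma monotone_m_matrix A : monotone_mx A -> m_matrix A.
Proof.
move=> Am; split=> [i j ij|i].
  have := Am (- delta_mx j 0) i.
  rewrite mulmxN -colE !mxE (negbTE ij) oppr0 lexx oppr_ge0; apply => // k.
  by rewrite !mxE oppr_le0; case: (_ && _).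
have := Am (const_mx 1) i; rewrite !mxE; under eq_bigr do rewrite mxE mulr1.
by apply => // k; rewrite !mxE.
Qed.

Lemma row_sumD A (a : R) i :
  \sum_j (A + a%:M) i j = \sum_j A i j + a.
Proof.
rewrite (eq_bigr (fun j => A i j + a%:M i j)) => [|j _]; last by rewrite mxE.
rewrite big_split /=; congr (_ + _); rewrite (bigD1 i)//= mxE eqxx mulr1n.
by rewrite big1 ?addr0// => j ji; rewrite mxE eq_sym (negbTE ji).
Qed.

Lemma irreducible_mxD A (a : R) :
  irreducible_mx A -> irreducible_mx (A + a%:M).
Proof.
move=> Airr I I0 IT; have [i [j [iI jI Aij]]] := Airr I I0 IT.
exists i, j; split=> //; have ij : i != j by apply: contraNneq jI => <-.
by rewrite !mxE (negbTE ij) addr0.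
Qed.

Lemma m_matrixD A (a : R) : 0 <= a -> m_matrix A -> m_matrix (A + a%:M).
Proof.
move=> a0 [Aoff Asum]; split=> [i j ij|i].
  by rewrite !mxE (negbTE ij) addr0 Aoff.
by rewrite row_sumD addr_ge0.
Qed.

Lemma row_mul_split A u i :
  \sum_j A i j * u j = (\sum_j A i j) * u i + \sum_j A i j * (u j - u i).
Proof.
rewrite mulr_suml -big_split; apply: eq_bigr => j _.
by rewrite /= mulrBr addrC subrK.
Qed.

Lemma row_diff_ge A u (b K : R) i : (forall i j, `|A i j| <= b) ->
  (forall i j, u i - u j <= K) ->
  - (m%:R * (b * K)) <= \sum_j A i j * (u j - u i).
Proof.
move=> Ab uK; rewrite -[m in m%:R]card_ord mulr_natl -sumr_const -sumrN.
apply: ler_sum => j _.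
have : `|A i j * (u j - u i)| <= b * K.
  rewrite normrM ler_pM// ler_norml lerNl opprB.
  by apply/andP; split; exact: uK.
by rewrite ler_norml => /andP[].
Qed.

(** The distance below the largest entry of [u] within which [s + 1] entries are
    known to lie: each step adds the gap that one row of [A u <= C] allows
    across an entry of [A] of size at least [d]. *)
Fixpoint spread (C b d : R) (s : nat) : R :=
  if s is t.+1 then spread C b d t + (C + m%:R * (b * spread C b d t)) / d else 0.

Lemma spread_ge0 (C b d : R) s : 0 <= C -> 0 <= b -> 0 < d -> 0 <= spread C b d s.
Proof.
move=> C0 b0 d0; elim: s => //= s IH.
by rewrite addr_ge0// divr_ge0 ?(ltW d0)// addr_ge0// !mulr_ge0.
Qed.

(** For nonnegative [u] and an entry [u i] close to the largest one, row [i] of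
    [A u <= C] bounds how far below [u i] the neighbours of [i] can lie;
    irreducibility then lets a set of large entries grow until it contains every
    index. *)
Lemma spread_bound A u (C b d : R) : m_matrix A -> 0 <= C -> 0 < d ->
  (forall i j, `|A i j| <= b) ->
  (forall I : {set 'I_m}, I != finset.set0 -> I \proper [set: 'I_m]%SET ->
    exists i j : 'I_m, [/\ i \in I, j \notin I & d <= `|A i j|]) ->
  (forall i, 0 <= u i) -> (forall i, \sum_j A i j * u j <= C) ->
  forall i j, u i - u j <= spread C b d m.
Proof.
move=> [Aoff Asum] C0 d0 Ab Ad u0 uC i0 j0.
have b0 : 0 <= b by apply: le_trans (Ab i0 i0).
have S0 s := @spread_ge0 C b d s C0 b0 d0.
have Smono s t : (s <= t)%N -> spread C b d s <= spread C b d t.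
  move=> /subnKC <-; elim: (t - s)%N => [|k IH]; first by rewrite addn0.
  rewrite addnS /= (le_trans IH)// lerDl divr_ge0 ?(ltW d0)// addr_ge0//.
  by rewrite !mulr_ge0.
have [k kmax] : exists k, forall i, u i <= u k.
  by exists [arg max_(i > i0) u i]%O; case: arg_maxP => // k _ h i; exact: h.
have key s : (s < m)%N -> exists I : {set 'I_m}, (s < #|I|)%N /\
    forall i, i \in I -> u k - u i <= spread C b d s.
  elim: s => [_|s IH sm].
    exists [set k]%SET; split=> [|i]; first by rewrite cards1.
    by rewrite inE => /eqP ->; rewrite subrr.
  have [I [sI Is]] := IH (ltnW sm).
  have [IT|IT] := eqVneq I [set: 'I_m]%SET.
    exists I; split; first by rewrite IT cardsT card_ord.
    by move=> i /Is/le_trans; apply; exact: Smono.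
  have [||i [j [iI jI dA]]] := Ad I.
  - by rewrite -card_gt0 (leq_ltn_trans _ sI).
  - by rewrite finset.properEneq IT finset.subsetT.
  have ij : i != j by apply: contraNneq jI => <-.
  exists (j |: I)%SET; split; first by rewrite cardsU1 jI add1n ltnS.
  move=> l; rewrite !inE => /orP[/eqP ->|/Is/le_trans]; last by apply; exact: Smono.
  have gap : - A i j * (u i - u j) <= C + m%:R * (b * spread C b d s).
    have := uC i; rewrite row_mul_split [X in _ + X](bigD1 j)//=.
    have h1 : 0 <= (\sum_j A i j) * u i by rewrite mulr_ge0.
    have h2 : - \sum_(l < m | l != j) A i l * (u l - u i) <=
        m%:R * (b * spread C b d s).
      rewrite -sumrN (le_trans (y := \sum_(l < m | l != j) b * spread C b d s))//.
        apply: ler_sum => h _; have [->|ih] := eqVneq h i.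
          by rewrite subrr mulr0 oppr0 mulr_ge0.
        have Aih : A i h <= 0 by rewrite Aoff// eq_sym.
        rewrite -mulNr; have [uhi|uhi] := leP (u h) (u i).
          by rewrite (le_trans (y := 0)) ?mulr_ge0// mulr_ge0_le0 ?oppr_ge0 ?subr_le0.
        apply: ler_pM; rewrite ?oppr_ge0 ?subr_ge0 ?(ltW uhi)//.
          by rewrite (le_trans _ (Ab i h))// -normrN ler_norm.
        by rewrite (le_trans _ (Is i iI))// lerD2r.
      rewrite sumr_const -[leLHS]mulr_natl ler_wpM2r ?mulr_ge0// ler_nat.
      by rewrite -[leqRHS]card_ord max_card.
    rewrite mulNr -mulrN opprB; move: h1 h2; clear.
    by lra.
  have dA' : d <= - A i j by move: dA; rewrite ler0_norm// Aoff.
  have uk := Is i iI; rewrite /=.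
  have : u i - u j <= (C + m%:R * (b * spread C b d s)) / d.
    rewrite ler_pdivlMr// mulrC.
    have [uij|uij] := leP (u i) (u j).
      rewrite (le_trans (y := 0))//; first by rewrite mulr_ge0_le0 ?(ltW d0) ?subr_le0.
      by rewrite addr_ge0// !mulr_ge0.
    by rewrite (le_trans _ gap)// ler_wpM2r// subr_ge0 ltW.
  by move: uk; clear; lra.
have m0 : (0 < m)%N := leq_ltn_trans (leq0n _) (ltn_ord i0).
have [I [mI Im]] := key m.-1 (eq_ind_r (fun k => k <= m)%N (leqnn m) (prednK m0)).
have IT : I = [set: 'I_m]%SET.
  by apply/eqP; rewrite eqEcard finset.subsetT cardsT card_ord (leq_trans (leqSpred m)).
have : u k - u j0 <= spread C b d m.-1 by apply: Im; rewrite IT inE.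
have := Smono _ _ (leq_pred m); have := kmax i0; lra.
Qed.

End Matrices.

Section Coupling.
Context {R : realType} {m n : nat}.
Implicit Types (B : 'rV[R]_n -> 'M[R]_m) (u : 'I_m -> 'rV[R]_n -> R).

Lemma torus_continuous_sum (I : finType) (P : pred I) (f : I -> 'rV[R]_n -> R) :
  (forall i, torus_continuous (f i)) ->
  torus_continuous (fun x => \sum_(i | P i) f i x).
Proof.
move=> fT; split=> [x|x k]; last by apply: eq_bigr => i _; rewrite (fT i).2.
by apply: sum_continuous => i; exact: (fT i).1.
Qed.

Lemma torus_family_bounded (I : finType) (f : I -> 'rV[R]_n -> R) :
  (forall i, torus_continuous (f i)) -> exists b : R, forall i x, `|f i x| <= b.
Proof.
move=> fT; suff : \forall b \near +oo, forall i x, `|f i x| <= b.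
  by move=> /filter_ex[b fb]; exists b.
apply: filter_forall => i; have [M fM] := torus_bounded (fT i).
near=> b => x; apply: (le_trans (fM x)); near: b; apply: nbhs_pinfty_ge.
exact: num_real.
Unshelve. all: by end_near. Qed.

Lemma uniformly_bounded B : (forall i j, torus_continuous (fun x => B x i j)) ->
  exists b : R, forall x i j, `|B x i j| <= b.
Proof.
move=> Bc; have [b Bb] := torus_family_bounded (fun p : 'I_m * 'I_m => Bc p.1 p.2).
by exists b => x i j; exact: (Bb (i, j)).
Qed.

(** Compactness of the torus turns pointwise irreducibility into a lower bound
    [d]: for each of the finitely many sets [I], the sum of the entries leading
    out of [I] is continuous and positive. *)
Lemma uniformly_irreducible B :
  (forall i j, torus_continuous (fun x => B x i j)) ->
  (forall x, irreducible_mx (B x)) ->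
  exists2 d : R, 0 < d & forall x (I : {set 'I_m}), I != finset.set0 ->
    I \proper [set: 'I_m]%SET ->
    exists i j : 'I_m, [/\ i \in I, j \notin I & d <= `|B x i j|].
Proof.
move=> Bc Birr; suff : \forall d \near 0^'+, forall (I : {set 'I_m}) x,
    I != finset.set0 -> I \proper [set: 'I_m]%SET ->
    exists i j : 'I_m, [/\ i \in I, j \notin I & d <= `|B x i j|].
  move=> h; have [d [dI d0]] := filter_ex (filterI h (nbhs_right_gt (0 : R))).
  by exists d => // x I; exact: dI.
apply: filter_forall => I.
have [I0|I0] := eqVneq I finset.set0; first by near=> d.
have [IT|IT] := boolP (I \proper [set: 'I_m]%SET); last by near=> d.
pose P (p : 'I_m * 'I_m) := (p.1 \in I) && (p.2 \notin I).
pose f x := \sum_(p | P p) `|B x p.1 p.2|.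
have fT : torus_continuous f.
  apply: torus_continuous_sum => p; have [c per] := Bc p.1 p.2.
  by split=> [x|x k]; [exact: (cvg_norm (c x)) | rewrite per].
have [z zmin] := torus_min fT.
have fz : 0 < f z.
  have [i [j [iI jI Bij]]] := Birr z I I0 IT.
  rewrite /f (bigD1 (i, j))/= /P ?iI// ltr_pwDl ?normr_gt0//.
  by apply: sumr_ge0.
pose N : R := #|{: 'I_m * 'I_m}|%:R.
have N0 : 0 < N + 1 by rewrite ltr_wpDl// ler0n.
(* If all entries leading out of [I] were below [d], then [f x] would be at most
   [N * d], which is less than the minimum [f z]. *)
near=> d => x _ _; apply: contrapT => noij.
have dN : d <= f z / (N + 1).
  by near: d; apply: nbhs_right_le; rewrite divr_gt0.
have : f z < f z; last by rewrite ltxx.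
apply: (le_lt_trans (zmin x)); apply: (@le_lt_trans _ _ (N * d)).
  rewrite /f /N mulr_natl -sumr_const big_mkcond; apply: ler_sum => p _.
  have d0 : 0 <= d by near: d; exact: nbhs_right_ge.
  case: ifP => // /andP[p1 p2]; rewrite leNgt; apply/negP => /ltW dB.
  by apply: noij; exists p.1, p.2.
rewrite ler_pdivlMr// in dN.
have d0 : 0 < d by near: d; exact: nbhs_right_gt.
by rewrite (lt_le_trans _ dN)// mulrDr mulr1 mulrC ltrDl.
Unshelve. all: by end_near. Qed.

Lemma couplingD B (a : R) u i x :
  coupling (fun y => B y + a%:M) u i x = coupling B u i x + a * u i x.
Proof.
rewrite /coupling (eq_bigr (fun j => B x i j * u j x + a%:M i j * u j x)); last first.
  by move=> j _; rewrite mxE mulrDl.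
rewrite big_split; congr (_ + _); rewrite (bigD1 i)//= mxE eqxx mulr1n.
by rewrite big1 ?addr0// => j ji; rewrite mxE eq_sym (negbTE ji) mulr0n mul0r.
Qed.

Lemma torus_continuous_coupling B u i :
  (forall i j, torus_continuous (fun x => B x i j)) ->
  (forall i, torus_continuous (u i)) -> torus_continuous (coupling B u i).
Proof.
move=> Bc uc; apply: torus_continuous_sum => j; split=> [x|x k].
  exact: (cvgM ((Bc i j).1 x) ((uc j).1 x)).
by rewrite (Bc i j).2 (uc j).2.
Qed.

End Coupling.

(** * Estimates for subsolutions *)

Section Systems.
Context {R : realType} {m n : nat}.
Implicit Types (B : 'rV[R]_n -> 'M[R]_m) (u v : 'I_m -> 'rV[R]_n -> R).
Implicit Types (H : 'I_m -> 'rV[R]_n -> 'rV[R]_n -> R).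

Definition torus_coupling B : Prop :=
  (forall i j, torus_continuous (fun x => B x i j)) /\ forall x, m_matrix (B x).

Definition torus_hamiltonian H : Prop :=
  (forall i, continuous (fun z : 'rV[R]_n * 'rV[R]_n => H i z.1 z.2)) /\
  (forall i p, Zperiodic (fun x => H i x p)).

Definition bounded_sublevels H : Prop :=
  forall a : R, exists r, forall i x p, H i x p <= a -> `|p| <= r.

Definition nonneg_subsolution B H (c : R) u : Prop :=
  viscosity_subsolution B H (fun=> c) u /\ forall i x, 0 <= u i x.

Lemma torus_couplingD B (a : R) : 0 <= a -> torus_coupling B ->
  torus_coupling (fun x => B x + a%:M).
Proof.
move=> a0 [Bc BM]; split=> [i j|x]; last exact: m_matrixD.
have [c per] := Bc i j; split=> [x|x k]; last by rewrite !mxE per.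
rewrite (_ : (fun y => _) = fun y => B y i j + a%:M i j); last first.
  by apply/funext => y; rewrite mxE.
exact: (cvgD (c x) (cvg_cst _)).
Qed.

Lemma oscillation_continuous (f : 'rV[R]_n -> R) (K : R) :
  (forall x z, f z - f x <= K * `|z - x|) -> continuous f.
Proof.
move=> fK x; apply/(@cvgrPdist_lt _ _ _ (nbhs x)) => e e0.
have K1 : 0 < `|K| + 1 by rewrite ltr_wpDl.
have lip a b : f a - f b <= (`|K| + 1) * `|a - b|.
  rewrite (le_trans (fK b a))// ler_wpM2r//.
  by rewrite (le_trans (ler_norm K))// lerDl.
apply/nbhs_ballP; exists (e / (`|K| + 1)) => [|z]; first exact: divr_gt0.
rewrite -ball_normE /ball_ /= ltr_pdivlMr// mulrC => xz.
have h1 := lip x z; have h2 := lip z x; rewrite distrC in h2.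
by rewrite (le_lt_trans _ xz)// ler_norml; apply/andP; split; lra.
Qed.

(** Since [H] is bounded below, the coupling term of a subsolution is bounded
    above, first where it is touched, then everywhere by density. *)
Lemma subsolution_coupling_le B H (c C0 : R) u :
  torus_coupling B -> (forall i x p, - C0 <= H i x p) ->
  viscosity_subsolution B H (fun=> c) u ->
  forall i x, coupling B u i x <= c + C0.
Proof.
move=> [Bc _] HC [uT usub] i x; rewrite -subr_le0.
apply: (touching_dense (u := u i)
  (G := fun y => coupling B u i y - (c + C0))) => // [y|psi y psiC ymax].
  exact: (cvgB ((torus_continuous_coupling i Bc uT).1 y) (cvg_cst _)).
by have := usub i psi y psiC ymax; have := HC i y (grad psi y); lra.
Qed.

(** Estimates uniform in the discount [a]. The coupling bound and irreducibility
    control the differences between components; these bound the coupling term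
    from below, so that coercivity bounds the gradients of test functions. *)
Lemma nonneg_subsolution_estimates B H (c C0 : R) :
  torus_coupling B -> (forall x, irreducible_mx (B x)) ->
  bounded_sublevels H -> (forall i x p, - C0 <= H i x p) -> 0 <= c + C0 ->
  exists2 K, 0 <= K & forall (a : R) u, 0 <= a ->
    nonneg_subsolution (fun x => B x + a%:M) H c u ->
    [/\ forall i j x, u i x - u j x <= K,
        forall i x z, u i z - u i x <= K * `|z - x|,
        forall i x, coupling B u i x <= c + C0 &
        forall i x, a * u i x <= c + C0].
Proof.
move=> BT Birr Hsub HC cC; have [Bc BM] := BT.
have [b Bb] := uniformly_bounded Bc.
have [d d0 Bd] := uniformly_irreducible Bc Birr.
pose S : R := `|@spread R m (c + C0) b d m|.
have [r Hr] := Hsub (c + m%:R * (`|b| * S)).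
pose r' : R := `|r|; pose K : R := S + (n%:R * r' + 1) * n%:R.
have S0 : 0 <= S by exact: normr_ge0.
have r0 : 0 <= r' by exact: normr_ge0.
have L0 : 0 <= (n%:R * r' + 1) * n%:R by rewrite mulr_ge0// addr_ge0// mulr_ge0.
exists K => [|a u a0 [usub u0]]; first by rewrite addr_ge0.
have uT := usub.1; have BaT := torus_couplingD a0 BT.
have pt := subsolution_coupling_le BaT HC usub.
have cpl i x : coupling B u i x <= c + C0.
  have := pt i x; rewrite couplingD => h; rewrite (le_trans _ h)// lerDl.
  by rewrite mulr_ge0.
have Su i j x : u i x - u j x <= S.
  apply: (le_trans _ (ler_norm _)).
  exact: (@spread_bound R m (B x) (u^~ x) _ _ _ (BM x) cC d0 (Bb x) (Bd x)
    (u0^~ x) (cpl^~ x)).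
split=> // [i j x|i x z|i x].
- by rewrite (le_trans (Su i j x))// lerDl.
- apply: (@le_trans _ _ ((n%:R * r' + 1) * n%:R * `|z - x|)); last first.
    by rewrite ler_wpM2r// lerDr.
  apply: (lipschitz_of_test_gradients (uT i)) => // psi y psiC ymax.
  apply: (le_trans _ (ler_norm r)); apply: (Hr i y).
  have := usub.2 i psi y psiC ymax; rewrite couplingD.
  suff : - (m%:R * (`|b| * S)) <= coupling B u i y.
    move: (mulr_ge0 a0 (u0 i y)); move: (m%:R * _) (coupling _ _ _ _) (a * _).
    by move: (H _ _ _); clear=> *; lra.
  rewrite /coupling (row_mul_split (B y) (u^~ y)).
  rewrite (le_trans (y := \sum_j B y i j * (u j y - u i y)))//; last first.
    by rewrite lerDr mulr_ge0// (BM y).2.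
  apply: (row_diff_ge (u := u^~ y)) => [k l|k l]; last exact: Su.
  by rewrite (le_trans (Bb y k l))// ler_norm.
- (* At an index of the largest component the coupling term is nonnegative. *)
  have [k kmax] : exists k, forall i, u i x <= u k x.
    by exists [arg max_(k > i) u k x]%O; case: arg_maxP => // k _ h j; exact: h.
  have := pt k x; rewrite couplingD.
  suff : 0 <= coupling B u k x.
    move: (ler_wpM2l a0 (kmax i)); move: (coupling _ _ _ _) (a * _) (a * _).
    by clear=> *; lra.
  rewrite /coupling (row_mul_split (B x) (u^~ x)) addr_ge0 ?mulr_ge0//.
    exact: (BM x).2.
  apply: sumr_ge0 => j _; have [->|kj] := eqVneq k j.
    by rewrite subrr mulr0.
  by rewrite mulr_le0 ?(BM x).1// subr_le0.
Qed.

Lemma nonneg_subsolution0 B H (c : R) : (forall i x, H i x 0 <= c) ->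
  nonneg_subsolution B H c (fun _ _ => 0).
Proof.
move=> Hc; split=> //; split=> [i|i psi x psiC xmax].
  exact/torus_C1_continuous/torus_C1_cst.
rewrite -(grad_eq_at_max (torus_C1_cst 0) psiC xmax) grad_cst /coupling.
by rewrite big1 ?add0r// => j _; rewrite mulr0.
Qed.

Lemma torus_continuous_max (f g : 'rV[R]_n -> R) : torus_continuous f ->
  torus_continuous g -> torus_continuous (fun x => Num.max (f x) (g x)).
Proof.
move=> [fc fp] [gc gp]; split=> [x|x k]; last by rewrite fp gp.
exact: (continuous_max (fc x) (gc x)).
Qed.

End Systems.

(** * Perron's method *)

Section Perron.
Context {R : realType} {m n : nat}.
Implicit Types (B : 'rV[R]_n -> 'M[R]_m) (u v : 'I_m -> 'rV[R]_n -> R).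
Implicit Types (H : 'I_m -> 'rV[R]_n -> 'rV[R]_n -> R).

Lemma residual_continuous B H v i : torus_coupling B -> torus_hamiltonian H ->
  (forall j, torus_continuous (v j)) ->
  continuous (fun z : 'rV[R]_n * 'rV[R]_n => coupling B v i z.1 + H i z.1 z.2).
Proof.
move=> [Bc _] [Hc _] vT z.
have cc : {for z, continuous (fun z : 'rV[R]_n * 'rV[R]_n => coupling B v i z.1)}.
  apply: (@continuous_comp _ _ _ fst (coupling B v i)); first exact: cvg_fst.
  exact: (torus_continuous_coupling i Bc vT).1.
exact: (cvgD cc (Hc i z)).
Qed.

(** If the supersolution test of [v] fails at [x], lifting component [i] near
    [x] by the test function, lowered by a bump and raised by a small constant,
    gives a larger subsolution. The other components only benefit, since their
    coupling to component [i] is nonpositive. *)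
Lemma perron_bump B H (c : R) v i psi x :
  torus_coupling B -> torus_hamiltonian H -> nonneg_subsolution B H c v ->
  torus_C1 psi -> minimum_point (fun y => v i y - psi y) x ->
  coupling B v i x + H i x (grad psi x) < c ->
  exists u, nonneg_subsolution B H c u /\ v i x < u i x.
Proof.
move=> BT HT [[vT vsub] v0] psiC xmin xc; have [Bc BM] := BT.
have [b Bb] := uniformly_bounded Bc.
have b0 : 0 <= b by apply: le_trans (Bb x i i).
pose phi y := psi y - bump x 0 1 y.
have bC := bump_C1 x 0 (1 : R); have nbC := torus_C1N bC.
have phiC : torus_C1 phi := torus_C1D psiC nbC.
have phix : grad phi x = grad psi x.
  have [pd _ _] := psiC; have [bd _ _] := bC; have [nbd _ _] := nbC.
  by rewrite gradD// gradN// grad_bump_center oppr0 addr0.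
pose G y := coupling B v i y + H i y (grad phi y).
have [_ gc _] := phiC.
have Gc : {for x, continuous G}.
  apply: (@continuous_comp _ _ _ (fun y => (y, grad phi y))
    (fun z : 'rV[R]_n * 'rV[R]_n => coupling B v i z.1 + H i z.1 z.2)).
    exact: (cvg_pair cvg_id (gc x)).
  exact: residual_continuous.
pose e := (c - G x) / 2.
have e0 : 0 < e by rewrite divr_gt0// subr_gt0 /G phix.
have [d d0 dP] := near_ball (continuous_dist Gc e0).
pose t := Num.min (d ^+ 2) (e / (b + 1)).
have b1 : 0 < b + 1 by rewrite ltr_wpDl.
have t0 : 0 < t by rewrite lt_min exprn_gt0//= divr_gt0.
have td : t <= d ^+ 2 by rewrite ge_min lexx.
have bt : b * t <= e.
  have te : t <= e / (b + 1) by rewrite ge_min lexx orbT.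
  by move: te; rewrite ler_pdivlMr//; move: t0; clear; nra.
pose s := v i x - psi x + t.
pose zeta y := phi y + s.
have zetaC : torus_C1 zeta := torus_C1D phiC (torus_C1_cst s).
have zetagrad y : grad zeta y = grad phi y.
  have [pd _ _] := phiC; have [sd _ _] := torus_C1_cst (n := n) s.
  have -> : grad zeta y = grad phi y + grad (fun=> s) y := gradD (pd y) (sd y).
  by move: (grad phi y) => q; rewrite (grad_cst s y) addr0.
pose u j y := if j == i then Num.max (v i y) (zeta y) else v j y.
have uT j : torus_continuous (u j).
  rewrite /u; case: eqP => _; last exact: vT.
  by apply: torus_continuous_max => //; exact: torus_C1_continuous.
have vu j y : v j y <= u j y.
  by rewrite /u; case: eqP => [->|//]; rewrite le_max lexx.
have uE j y : j != i -> u j y = v j y by rewrite /u => /negbTE ->.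
exists u; split; last first.
  rewrite /u eqxx lt_max /zeta /phi bump_center subr0 /s; apply/orP; right.
  by move: t0; clear; lra.
split=> [|j y]; last exact: le_trans (vu j y).
split; first exact: uT.
move=> j chi y chiC ymax; have [ji|ji] := eqVneq j i; last first.
  have vmax : maximum_point (fun z => v j z - chi z) y.
    by move=> z; have := ymax z; rewrite !uE.
  apply: le_trans (vsub j chi y chiC vmax); rewrite lerD2r; apply: ler_sum => l _.
  have [->|li] := eqVneq l i; last by rewrite uE.
  by rewrite ler_wnM2l// (BM y).1.
rewrite {j}ji in ymax *.
have [zv|vz] := leP (zeta y) (v i y).
  have uv l : u l y = v l y by rewrite /u; case: eqP => // ->; rewrite max_l.
  have -> : coupling B u i y = coupling B v i y.
    by apply: eq_bigr => l _; rewrite uv.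
  apply: vsub => // z; have := ymax z; rewrite uv; apply: le_trans.
  by rewrite lerD2r vu.
have uiy : u i y = zeta y by rewrite /u eqxx max_r// ltW.
have chigrad : grad chi y = grad phi y.
  rewrite -zetagrad; apply/esym/grad_eq_at_max => // z.
  have := ymax z; rewrite /= uiy; apply: le_trans; rewrite lerD2r.
  by rewrite /u eqxx le_max lexx orbT.
have gap : zeta y - v i y <= t - bump x 0 1 y.
  have := xmin y; rewrite /zeta /phi /s /=; clear; lra.
(* The lift is active at [y] only if the bump is below [t], so a translate of
   [y] is close to [x], where the inequality for [psi] is strict. *)
have [k yk] := torus_shift y x.
have yd : `|y + map_mx intr k - x| < d.
  rewrite -(ltr_pXn2r (n := 2))// ?nnegrE ?(ltW d0)//.
  have := bump0_ge ler01 yk; rewrite mul1r => /le_lt_trans; apply.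
  have [_ _ ->] := bC; move: gap vz td; clear; lra.
have Gy : G y < G x + e.
  have -> : G y = G (y + map_mx intr k).
    rewrite /G (torus_continuous_coupling i Bc vT).2 (grad_periodic phiC).
    by rewrite (HT.2 i (grad phi y)).
  by have := dP _ yd; rewrite ltr_norml => /andP[_]; rewrite ltrBlDl.
have cu : coupling B u i y <= coupling B v i y + b * t.
  rewrite /coupling (bigD1 i)//= [X in _ <= X + _](bigD1 i)//= uiy.
  rewrite (eq_bigr (fun j => B y i j * v j y)) => [|j ji]; last by rewrite uE.
  have h : B y i i * (zeta y - v i y) <= b * t.
    have w0 : 0 <= zeta y - v i y by rewrite subr_ge0 ltW.
    have wt : zeta y - v i y <= t by apply: (le_trans gap); rewrite gerBl bump0_ge0.
    apply: (le_trans (ler_wpM2r w0 (ler_norm _))).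
    exact: (ler_pM (normr_ge0 _) w0 (Bb y i i) wt).
  move: h; rewrite mulrBr; move: (B y i i * _) (B y i i * _) (b * _) (\sum_(_ | _) _).
  by clear=> *; lra.
have ce : G x + e + e = c by rewrite /e; move: (G x) => q; clear; lra.
rewrite chigrad; move: (ltW Gy); rewrite -[G y]/(_ + H i y (grad phi y)).
move: cu bt ce; move: (coupling _ _ _ _) (coupling _ _ _ _) (H _ _ _) (G x) (e).
by move: (b * t); clear=> *; lra.
Qed.

(** The pointwise supremum of all nonnegative subsolutions is a solution. The
    common Lipschitz bound makes it continuous, so no comparison principle is
    involved. *)
Lemma perron B H (c K M : R) : torus_coupling B -> torus_hamiltonian H ->
  (forall i x, H i x 0 <= c) ->
  (forall u, nonneg_subsolution B H c u ->
    (forall i x, u i x <= M) /\ forall i x z, u i z - u i x <= K * `|z - x|) ->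
  exists v, viscosity_solution B H (fun=> c) v /\ forall i x, 0 <= v i x.
Proof.
move=> BT HT Hc est; have [Bc BM] := BT.
have [b Bb] := uniformly_bounded Bc.
pose S i x := [set u i x | u in nonneg_subsolution B H c].
pose v i x := sup (S i x).
have z0 := nonneg_subsolution0 B Hc.
have Ssup i x : has_sup (S i x).
  split; first by exists 0, (fun _ _ => 0).
  by exists M => _ [u us <-]; exact: (est u us).1.
have uv u i x : nonneg_subsolution B H c u -> u i x <= v i x.
  by move=> us; apply: ub_le_sup; [exact: (Ssup i x).2 | exists u].
have v0 i x : 0 <= v i x by exact: (uv (fun _ _ => 0)).
have vlip i x z : v i z - v i x <= K * `|z - x|.
  rewrite lerBlDr; apply: sup_le_ub; first exact: (Ssup i z).1.
  move=> _ [u us <-]; have := (est u us).2 i x z; have := uv u i x us.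
  by move: (K * _) (u i z) (u i x) (v i x); clear=> *; lra.
have vT i : torus_continuous (v i).
  split=> [|x k]; first exact: oscillation_continuous (vlip i).
  rewrite /v; congr sup; apply/seteqP; split=> _ [u us <-]; exists u => //.
    by rewrite (us.1.1 i).2.
  by rewrite (us.1.1 i).2.
have vsub : viscosity_subsolution B H (fun=> c) v.
  split=> // i psi x psiC xmax; rewrite -subr_le0.
  have b0 : 0 <= b by apply: le_trans (Bb x i i).
  have b1 : 0 < b + 1 by rewrite ltr_wpDl.
  apply: (@viscosity_stability _ _ (v i) psi x
    (fun y p => coupling B v i y + H i y p - c)) => // [z|e e0].
    have rc := @residual_continuous B H v i BT HT vT z.
    exact: (cvgB rc (cvg_cst c)).
  exists (e / (b + 1)) => [|d d0]; first by rewrite divr_gt0.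
  have [_ [u us <-] ux] := sup_adherent d0 (Ssup i x).
  exists (u i); split.
  - exact: us.1.1.
  - by move=> y; rewrite (le_trans (uv u i y us))// lerDl ltW.
  - exact: ltW.
  move=> phi y phiC ymax uvr; have := us.1.2 i phi y phiC ymax.
  suff : coupling B v i y - coupling B u i y <= e.
    by move: (coupling _ _ _ _) (coupling _ _ _ _) (H _ _ _); clear=> *; lra.
  rewrite /coupling -sumrB (bigD1 i)//= -[e]addr0 lerD//.
    rewrite -mulrBr (le_trans (ler_norm _))// normrM distrC.
    apply: (@le_trans _ _ (b * (e / (b + 1)))).
      exact: (ler_pM (normr_ge0 _) (normr_ge0 _) (Bb y i i) uvr).
    by rewrite mulrCA ger_pMr// ler_pdivrMr// mul1r lerDl.
  apply: sumr_le0 => j ji; rewrite -mulrBr mulr_le0_ge0 ?subr_ge0 ?uv//.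
  by rewrite (BM y).1// eq_sym.
exists v; split=> //; split=> //; split=> // i psi x psiC xmin.
rewrite leNgt; apply/negP => vc.
have [u [us]] := perron_bump BT HT (conj vsub v0) psiC xmin vc.
by rewrite ltNge uv.
Qed.

End Perron.

(** * Passage to the limit *)

Section Limits.
Context {R : realType} {m n : nat}.
Implicit Types (B : 'rV[R]_n -> 'M[R]_m) (u v w : 'I_m -> 'rV[R]_n -> R).
Implicit Types (H : 'I_m -> 'rV[R]_n -> 'rV[R]_n -> R).

Lemma coupling_dist_le B (b e : R) u v i x : 0 <= e ->
  (forall x i j, `|B x i j| <= b) -> (forall j x, `|u j x - v j x| <= e) ->
  `|coupling B u i x - coupling B v i x| <= m%:R * (b * e).
Proof.
move=> e0 Bb uv; rewrite /coupling -sumrB (le_trans (ler_norm_sum _ _ _))//.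
rewrite -[m in m%:R]card_ord mulr_natl -sumr_const; apply: ler_sum => j _.
by rewrite -mulrBr normrM ler_pM.
Qed.

(** The supersolution half is the stability lemma applied to [- v] and to the
    reflected Hamiltonian. *)
Lemma solution_stability B H (c : R) v :
  torus_coupling B -> torus_hamiltonian H -> (forall i, torus_continuous (v i)) ->
  (forall e : R, 0 < e -> exists (a c' : R) u,
    [/\ viscosity_solution (fun x => B x + a%:M) H (fun=> c') u,
      forall i x, `|u i x - v i x| <= e, `|c' - c| <= e &
      forall i x, `|a * u i x| <= e]) ->
  viscosity_solution B H (fun=> c) v.
Proof.
move=> BT HT vT approx; have [Bc _] := BT.
have [b' Bb'] := uniformly_bounded Bc.
pose b : R := `|b'|; have b0 : 0 <= b := normr_ge0 _.
have Bb x i j : `|B x i j| <= b := le_trans (Bb' x i j) (ler_norm _).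
have mb0 : 0 < m%:R * b + 2 by rewrite ltr_wpDl// mulr_ge0.
(* For [u] within [t] of [v], the errors from the coupling, the discount and the
   constant add up to (m b + 2) t. *)
have {}approx (e d : R) : 0 < e -> 0 < d -> exists (a c' : R) u,
    [/\ viscosity_solution (fun x => B x + a%:M) H (fun=> c') u,
      forall i x, `|u i x - v i x| <= d &
      forall i x, `|coupling (fun x => B x + a%:M) u i x - c' -
        (coupling B v i x - c)| <= e].
  move=> e0 d0; pose t : R := Num.min d (e / (m%:R * b + 2)).
  have t0 : 0 < t by rewrite lt_min d0 divr_gt0.
  have te : (m%:R * b + 2) * t <= e.
    by rewrite mulrC -ler_pdivlMr// ge_min lexx orbT.
  have [a [c' [u [us uv cc au]]]] := approx t t0.
  exists a, c', u; split=> // i x.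
    by rewrite (le_trans (uv i x))// ge_min lexx.
  apply: le_trans te; have := coupling_dist_le i x (ltW t0) Bb uv.
  have := au i x; move: cc; rewrite couplingD mulrDl -mulrA !ler_norml.
  move: (coupling _ _ _ _) (coupling _ _ _ _) (m%:R * (b * t)) (a * u i x) (t).
  clear=> ? ? ? ? ? /andP[? ?] /andP[? ?] /andP[? ?].
  by apply/andP; split; lra.
split; split=> // i psi x psiC xmax.
  rewrite -subr_le0; apply: (@viscosity_stability _ _ (v i) psi x
    (fun y p => coupling B v i y + H i y p - c)) => // [z|e e0].
    have rc := @residual_continuous _ _ _ B H v i BT HT vT z.
    exact: (cvgB rc (cvg_cst c)).
  exists 1 => // d d0; have [a [c' [u [us uv cu]]]] := approx e d e0 d0.
  have [[uT usub] _] := us; exists (u i); split=> // [y||phi y phiC ymax _].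
  - have := uv i y; rewrite ler_norml; move: (u i y) (v i y).
    by clear=> ? ? /andP[? ?]; lra.
  - have := uv i x; rewrite ler_norml; move: (u i x) (v i x).
    by clear=> ? ? /andP[? ?]; lra.
  have := usub i phi y phiC ymax; have := cu i y; rewrite ler_norml.
  move: (coupling _ _ _ _) (coupling _ _ _ _) (H _ _ _).
  by clear=> ? ? ? /andP[? ?] ?; lra.
have npsiC := torus_C1N psiC; have [psid _ _] := psiC.
rewrite -subr_le0 -[grad psi x]opprK -(gradN (psid x)).
apply: (@viscosity_stability _ _ (fun y => - v i y) (fun y => - psi y) x
  (fun y p => c - (coupling B v i y + H i y (- p)))) => // [||z|e e0].
- exact: torus_continuousN.
- by move=> y; have := xmax y; rewrite /=; clear; lra.
- have rc := @residual_continuous _ _ _ B H v i BT HT vT (z.1, - z.2).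
  have nc : {for z, continuous (fun z : 'rV[R]_n * 'rV[R]_n => (z.1, - z.2))}.
    have fc : {for z, continuous (fst : 'rV[R]_n * 'rV[R]_n -> 'rV[R]_n)}.
      exact: cvg_fst.
    have sc : {for z, continuous (snd : 'rV[R]_n * 'rV[R]_n -> 'rV[R]_n)}.
      exact: cvg_snd.
    exact: (cvg_pair fc (cvgN sc)).
  exact: (cvgB (cvg_cst c) (continuous_comp nc rc)).
exists 1 => // d d0; have [a [c' [u [us uv cu]]]] := approx e d e0 d0.
have [_ [uT usup]] := us.
exists (fun y => - u i y); split=> [|y||phi y phiC ymax _].
- exact: torus_continuousN.
- have := uv i y; rewrite ler_norml; move: (u i y) (v i y).
  by clear=> ? ? /andP[? ?]; lra.
- have := uv i x; rewrite ler_norml; move: (u i x) (v i x).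
  by clear=> ? ? /andP[? ?]; lra.
have [phid _ _] := phiC.
have ymin : minimum_point (fun z => u i z - - phi z) y.
  by move=> z; have := ymax z; rewrite /=; clear; lra.
have := usup i _ y (torus_C1N phiC) ymin; rewrite (gradN (phid y)).
have := cu i y; rewrite ler_norml.
move: (coupling _ _ _ _) (coupling _ _ _ _) (H _ _ _).
by clear=> ? ? ? /andP[? ?] ?; lra.
Qed.

Lemma ultra_bounded_cvg (U : set_system nat) (s : nat -> R) (M : R) :
  UltraFilter U -> (forall k, `|s k| <= M) -> exists l : R, s @ U --> l.
Proof.
move=> UU sM; have PU : ProperFilter U := @ultra_proper _ _ UU.
have sI : fmap s U `[- M, M]%classic.
  apply: (@filterS _ U _ setT) filterT => k _ /=.
  by have := sM k; rewrite ler_norml in_itv.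
have [l [_ cl]] := @segment_compact R (- M) M (fmap s U) (fmap_proper_filter s PU) sI.
exists l => V Vl; have [//|nV] := in_ultra_setVsetC (s @^-1` V) UU.
by have [y [nVy /nVy]] := cl (~` V) V nV Vl.
Qed.

(** Arzela-Ascoli along an ultrafilter: pointwise limits exist by compactness
    of bounded intervals, and equicontinuity upgrades them to uniform limits on
    the compact torus. *)
Lemma equilipschitz_limit (w : nat -> 'I_m -> 'rV[R]_n -> R) (c : nat -> R)
    (K M : R) :
  (forall k i, Zperiodic (w k i)) -> (forall k i x, `|w k i x| <= M) ->
  (forall k i x z, w k i z - w k i x <= K * `|z - x|) ->
  (forall k, `|c k| <= M) ->
  exists v c0, [/\ forall i, Zperiodic (v i),
    forall i x z, v i z - v i x <= K * `|z - x| &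
    forall (e : R) N, 0 < e -> exists k, [/\ (N <= k)%N,
      forall i x, `|w k i x - v i x| <= e & `|c k - c0| <= e]].
Proof.
move=> wp wM wK cM.
have [U [UU NU]] := ultraFilterLemma (eventually_filter : ProperFilter \oo).
have PU : ProperFilter U := @ultra_proper _ _ UU.
have [c0 cc0] := ultra_bounded_cvg UU cM.
have wl i x : exists l : R, (fun k => w k i x) @ U --> l.
  by apply: (ultra_bounded_cvg UU) => k; exact: wM.
pose v i x := xget 0 [set l : R | (fun k => w k i x) @ U --> l].
have wv i x : (fun k => w k i x) @ U --> v i x.
  by have [l wxl] := wl i x; rewrite /v; case: xgetP => [y _ //|/(_ l)].
have vK i x z : v i z - v i x <= K * `|z - x|.
  apply: (cvgr_to_le (cvgB (wv i z) (wv i x))).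
  by apply: (@filterS _ U _ setT) filterT => k _; exact: wK.
have close (e : R) i x : 0 < e -> \forall k \near U, `|w k i x - v i x| < e.
  by move=> e0; have /cvgrPdist_lt/(_ _ e0) := wv i x;
    apply: filterS => k; rewrite distrC.
have vp i : Zperiodic (v i).
  move=> x j; rewrite /v (_ : (fun k => w k i (x + map_mx intr j)) = w^~ i ^~ x)//.
  by apply/funext => k; rewrite wp.
exists v, c0; split=> // e N e0.
have e4 : 0 < e / 2 by rewrite divr_gt0.
have cube : \near U, [set x : 'rV[R]_n | `|x - 0| <= 1 / 2] `<=`
    (fun k x => forall i, `|w k i x - v i x| <= e) U.
  apply: ((compact_near_coveringP _).1 (@compact_cball R n 0 (1 / 2))) => x _.
  have K1 : 0 < 4 * (`|K| + 1) by rewrite mulr_gt0// ltr_wpDl.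
  have d0 : 0 < e / (4 * (`|K| + 1)) by rewrite divr_gt0.
  have wx : \forall k \near U, forall i, `|w k i x - v i x| < e / 2.
    by apply: filter_forall => i; exact: close.
  exists (ball x (e / (4 * (`|K| + 1))), [set k | forall i, `|w k i x - v i x| < e / 2]).
    by split=> //=; exact: nbhsx_ballx.
  move=> [y k] [/= yx wk] i.
  rewrite -ball_normE /ball_ /= ltr_pdivlMr// in yx.
  have lip (f : 'rV[R]_n -> R) : (forall x z, f z - f x <= K * `|z - x|) ->
      `|f x - f y| <= e / 4.
    move=> fK; have Kxy : K * `|x - y| <= e / 4.
      have KK := ler_wpM2r (normr_ge0 (x - y)) (ler_norm K).
      have := normr_ge0 (x - y); move: yx KK; move: `|x - y| `|K| => p q.
      clear; nra.
    have h1 := fK x y; have h2 := fK y x; rewrite distrC in h1.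
    by rewrite ler_norml; apply/andP; split; move: h1 h2 Kxy; clear; lra.
  have h1 := lip (w k i) (wK k i); have h2 := lip (v i) (vK i); have h3 := wk i.
  move: h1 h2 h3; rewrite !ler_norml ltr_norml.
  move: (w k i x) (w k i y) (v i x) (v i y); clear=> ? ? ? ? /andP[? ?] /andP[? ?] /andP[? ?].
  by apply/andP; split; lra.
have ck : \forall k \near U, `|c k - c0| < e.
  have /cvgrPdist_lt/(_ _ e0) := cc0; apply: filterS => k; rewrite distrC //.
have Nk : \forall k \near U, (N <= k)%N by apply: NU; exact: nbhs_infty_ge.
have [k [wk [cke Nke]]] := filter_ex (filterI cube (filterI ck Nk)).
exists k; split=> // [i x|]; last exact: ltW.
have [j xj] := torus_shift x 0.
by rewrite -(wp k i x j) -(vp i x j); exact: wk.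
Qed.


End Limits.

(** * Regularity of the Hamiltonian *)

Section Hamiltonians.
Context {R : realType} {m n : nat}.

Lemma compact_sup_attained (T : topologicalType) (f : T -> R) :
  compact [set: T] -> [set: T] !=set0 -> continuous f ->
  exists c, sup [set f t | t in [set: T]] = f c /\ forall t, f t <= f c.
Proof.
move=> Tc T0 fc.
have [c _ cmax] := compact_EVT_max T0 Tc (continuous_subspaceT fc).
have {}cmax t : f t <= f c by apply: cmax; rewrite inE.
exists c; split=> //; apply/eqP; rewrite eq_le; apply/andP; split.
  by apply: sup_le_ub; [exists (f c), c | move=> _ [t _ <-]].
by apply: ub_le_sup; [exists (f c) => _ [t _ <-] | exists c].
Qed.

(** Lower semicontinuity comes from a maximising parameter, upper semicontinuity
    from a tube around the compact fibre. *)
Lemma sup_continuous (X T : topologicalType) (f : X * T -> R) :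
  compact [set: T] -> [set: T] !=set0 -> continuous f ->
  continuous (fun x => sup [set f (x, t) | t in [set: T]]).
Proof.
move=> Tc T0 fc x.
have fx y : continuous (fun t => f (y, t)).
  move=> t; apply: (@continuous_comp _ _ _ (fun t => (y, t)) f); last exact: fc.
  exact: (cvg_pair (cvg_cst y) cvg_id).
have [c [cE cmax]] := compact_sup_attained Tc T0 (fx x).
apply/(@cvgrPdist_lt _ _ _ (nbhs x)) => e e0; rewrite cE.
set q : R := f (x, c).
have e2 : 0 < e / 2 by rewrite divr_gt0.
have low : \forall y \near x, q - e < f (y, c).
  have fyc : {for x, continuous (fun y => f (y, c))}.
    apply: (@continuous_comp _ _ _ (fun y => (y, c)) f); last exact: fc.
    exact: (cvg_pair cvg_id (cvg_cst c)).
  by apply: (cvgr_gt _ fyc); rewrite gtrBl.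
have upp : \near x, [set: T] `<=` (fun y t => f (y, t) < q + e / 2) x.
  apply: ((compact_near_coveringP _).1 Tc) => t _.
  have : \forall z \near (x, t), f z < q + e / 2.
    by apply: (cvgr_lt _ (fc (x, t))); rewrite (le_lt_trans (cmax t))// ltrDl.
  move=> [[U V] [/= Ux Vt] UV]; exists (V, U) => // -[s y] [Vs Uy]; exact: (UV (y, s) (conj Uy Vs)).
near=> y.
have [d [dE dmax]] := compact_sup_attained Tc T0 (fx y); rewrite dE.
have h1 : q - e < f (y, c) by near: y.
have h2 : forall t, [set: T] t -> f (y, t) < q + e / 2 by near: y.
have := h2 d I; have := dmax c; move: h1.
rewrite ltr_norml; move: e0; move: (q) (f (y, c)) (f (y, d)) (e : R).
by clear=> *; apply/andP; split; lra.
Unshelve. all: by end_near. Qed.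

Lemma torus_hamiltonian_sup (Xi : metricType R)
    (g : 'I_m -> 'rV[R]_n * Xi -> 'rV[R]_n) (L : 'I_m -> 'rV[R]_n * Xi -> R) :
  [set: Xi] !=set0 -> compact [set: Xi] ->
  (forall i, torus_prod_continuous (g i)) ->
  (forall i, torus_prod_continuous (L i)) ->
  torus_hamiltonian (hamiltonian g L).
Proof.
move=> Xi0 Xic gc Lc; split=> [i|i p x k]; last first.
  rewrite /hamiltonian; congr sup; apply/seteqP.
  by split=> _ [xi _ <-]; exists xi => //; rewrite (gc i).2 (Lc i).2.
pose f (z : ('rV[R]_n * 'rV[R]_n) * Xi) : R :=
  - dotp (g i (z.1.1, z.2)) z.1.2 - L i (z.1.1, z.2).
have fc : continuous f.
  move=> z; have zc : {for z, continuous
      (fun z : ('rV[R]_n * 'rV[R]_n) * Xi => (z.1.1, z.2))}.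
    have h1 : {for z, continuous (fun z : ('rV[R]_n * 'rV[R]_n) * Xi => z.1.1)}.
      by apply: (@continuous_comp _ _ _ fst fst); exact: cvg_fst.
    have h2 : {for z, continuous (fun z : ('rV[R]_n * 'rV[R]_n) * Xi => z.2)}.
      exact: cvg_snd.
    exact: (cvg_pair h1 h2).
  have pc : {for z, continuous (fun z : ('rV[R]_n * 'rV[R]_n) * Xi => z.1.2)}.
    by apply: (@continuous_comp _ _ _ fst snd); [exact: cvg_fst | exact: cvg_snd].
  have gzc := continuous_comp zc ((gc i).1 _).
  have Lzc := continuous_comp zc ((Lc i).1 _).
  exact: (cvgB (cvgN (dotp_continuous gzc pc)) Lzc).
exact: (sup_continuous Xic Xi0 fc).
Qed.

Implicit Types H : 'I_m -> 'rV[R]_n -> 'rV[R]_n -> R.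

Lemma torus_hamiltonian_at H i p : torus_hamiltonian H ->
  torus_continuous (fun x => H i x p).
Proof.
move=> [Hc Hp]; split=> [x|]; last exact: Hp.
have pc : {for x, continuous (fun y : 'rV[R]_n => (y, p))}.
  have cc : {for x, continuous (fun _ : 'rV[R]_n => p)} by exact: cst_continuous.
  have ic : {for x, continuous (@id 'rV[R]_n)} by exact: cvg_id.
  exact: (cvg_pair ic cc).
exact: (continuous_comp pc (Hc i (x, p))).
Qed.

Lemma coercive_bounded_sublevels H :
  torus_hamiltonian H -> coercive H -> bounded_sublevels H.
Proof.
move=> HT Hco a.
suff : \forall r \near +oo, forall i x p, H i x p <= a -> `|p| <= r.
  by move=> /filter_ex[r Hr]; exists r => i x p; exact: Hr.
apply: filter_forall => i.
have [r _ rH] := Hco i [set y | a < y] (nbhs_pinfty_gt (num_real a)).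
near=> s => x p Ha; rewrite leNgt; apply/negP => sp.
have rs : r <= s by near: s; apply: nbhs_pinfty_ge; exact: num_real.
have /= := rH p (le_lt_trans rs sp); rewrite ltNge => /negP; apply.
apply: le_trans Ha; apply: ge_inf; last by exists x.
have [y ymin] := torus_min (torus_hamiltonian_at i p HT).
by exists (H i y p) => _ [z _ <-]; exact: ymin.
Unshelve. all: by end_near. Qed.

Lemma bounded_below H : torus_hamiltonian H -> bounded_sublevels H ->
  exists2 C, 0 <= C & forall i x p, - C <= H i x p.
Proof.
move=> HT Hsub; have [r Hr] := Hsub 0; have [Hc Hp] := HT.
suff : \forall C \near +oo, forall i x p, - C <= H i x p.
  move=> h; have [C [CH C0]] := filter_ex (filterI h (nbhs_pinfty_ge (real0 R))).
  by exists C.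
apply: filter_forall => i.
pose K : set ('rV[R]_n * 'rV[R]_n) :=
  [set x | `|x - 0| <= 1 / 2] `*` [set p | `|p - 0| <= `|r|].
have K0 : K !=set0 by exists (0, 0); split; rewrite /= subrr normr0.
have Kc : compact K by apply: compact_setX; exact: compact_cball.
have [z _ zmin] := compact_EVT_min K0 Kc (continuous_subspaceT (Hc i)).
near=> C => x p.
have C0 : 0 <= C by near: C; exact: nbhs_pinfty_ge.
have Cz : - H i z.1 z.2 <= C by near: C; apply: nbhs_pinfty_ge; exact: num_real.
have [Hxp|/ltW/Hr pr] := leP 0 (H i x p); first by rewrite (le_trans _ Hxp)// oppr_le0.
have [k xk] := torus_shift x 0.
rewrite lerNl -(Hp i p x k); apply: le_trans Cz; rewrite lerN2.
apply: (zmin (x + map_mx intr k, p)); rewrite inE; split=> //=.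
by rewrite subr0 (le_trans pr)// ler_norm.
Unshelve. all: by end_near. Qed.

End Hamiltonians.

(** * The ergodic problem *)

Section Ergodic.
Context {R : realType} {m n : nat}.
Implicit Types (B : 'rV[R]_n -> 'M[R]_m) (u v w : 'I_m -> 'rV[R]_n -> R).
Implicit Types (H : 'I_m -> 'rV[R]_n -> 'rV[R]_n -> R).

Lemma torus_value_spread u (K : R) : 0 <= K -> (forall i, Zperiodic (u i)) ->
  (forall i j x, u i x - u j x <= K) ->
  (forall i x z, u i z - u i x <= K * `|z - x|) ->
  forall i j x y, u i x <= u j y + 2 * K.
Proof.
move=> K0 up ud uK i j x y; have [k xk] := torus_shift x y.
rewrite -(up i x k); have := uK i y (x + map_mx intr k); have := ud i j y.
have := ler_wpM2l K0 xk; move: (K * `|_|) (u i _) (u i y) (u j y).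
by move: K0; clear=> *; lra.
Qed.

Lemma lipschitz_of_bound (f : 'rV[R]_n -> R) (K : R) :
  (forall x z, f z - f x <= K * `|z - x|) -> lipschitz f.
Proof.
move=> fK; exists K; split; first exact: num_real.
move=> M KM [x z] _ /=; apply: (@le_trans _ _ (K * `|x - z|)); last first.
  by rewrite ler_wpM2r// ltW.
have h1 := fK z x; have h2 := fK x z; rewrite distrC in h2.
by rewrite ler_norml; apply/andP; split; move: h1 h2; clear; lra.
Qed.

(** A positive row sum at one point bounds component [i0] of every nonnegative
    subsolution there; the estimates propagate the bound to all components and
    points, so the largest subsolution is finite and solves the problem. *)
Lemma solution_of_row_sum_gt0 B H (c C0 : R) i0 x0 :
  torus_coupling B -> (forall x, irreducible_mx (B x)) ->
  torus_hamiltonian H -> bounded_sublevels H ->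
  (forall i x p, - C0 <= H i x p) -> (forall i x, H i x 0 <= c) ->
  0 < \sum_j B x0 i0 j ->
  exists v, viscosity_solution B H (fun=> c) v /\ forall i x, 0 <= v i x.
Proof.
move=> BT Birr HT Hsub HC Hc r0; have [Bc BM] := BT.
have cC : 0 <= c + C0.
  by have := Hc i0 x0; have := HC i0 x0 0; move: (H _ _ _); clear=> *; lra.
have [K K0 est] := nonneg_subsolution_estimates BT Birr Hsub HC cC.
have B0 : (fun x => B x + 0%:M) = B by apply/funext => x; rewrite raddf0 addr0.
have [b Bb] := uniformly_bounded Bc.
pose r := \sum_j B x0 i0 j; pose M := (c + C0 + m%:R * (b * K)) / r + 2 * K.
apply: (@perron _ _ _ B H c K M) => // u us.
have [|ud uK uc _] := est 0 u (lexx 0); first by rewrite B0.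
split=> // i x; apply: (le_trans (torus_value_spread K0 (fun i => (us.1.1 i).2)
  ud uK i i0 x x0)).
rewrite lerD2r ler_pdivlMr// mulrC.
have := uc i0 x0; rewrite /coupling (row_mul_split (B x0) (u^~ x0)) -/r.
have := row_diff_ge i0 (Bb x0) (fun i j => ud i j x0).
by move: (m%:R * (b * K)) (r * _) (\sum_(_ < _) _); clear=> *; lra.
Qed.

Lemma viscosity_solution_shift B H (c a mu : R) v :
  (forall x i, \sum_j B x i j = a) -> viscosity_solution B H (fun=> c) v ->
  viscosity_solution B H (fun=> c - a * mu) (fun i x => v i x - mu).
Proof.
move=> Ba [[vT vsub] [_ vsup]].
have wT i : torus_continuous (fun x => v i x - mu).
  split=> [x|x k]; last by rewrite (vT i).2.
  exact: (cvgB ((vT i).1 x) (cvg_cst _)).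
have cE i x : coupling B (fun i x => v i x - mu) i x = coupling B v i x - a * mu.
  rewrite -(Ba x i) mulr_suml -sumrB; apply: eq_bigr => j _.
  by rewrite mulrBr.
split; split=> // i psi x psiC xext.
  rewrite cE addrAC lerD2r; apply: vsub => // y.
  by have := xext y; rewrite /= addrAC [leRHS]addrAC lerD2r.
rewrite cE [leRHS]addrAC lerD2r; apply: vsup => // y.
by have := xext y; rewrite /= addrAC [leRHS]addrAC lerD2r.
Qed.

Lemma torus_min_family u (i0 : 'I_m) : (forall i, torus_continuous (u i)) ->
  exists i x, forall j y, u i x <= u j y.
Proof.
move=> uT; have /choice[z zmin] i := torus_min (uT i).
exists [arg min_(i < i0) u i (z i)]%O; case: arg_minP => // i _ imin.
by exists (z i) => j y; apply: (le_trans (imin j isT)); exact: zmin.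
Qed.

(** When the row sums of [B] vanish, subtracting the minimum [mu] from a
    discounted solution only changes the constant, by [a * mu], and this is
    controlled by the discount estimate. The shifted solution is again a
    nonnegative subsolution, now vanishing somewhere, so the estimates bound it
    uniformly in [a]. *)
Lemma normalized_discounted_solution B H (c C0 : R) : (0 < m)%N ->
  torus_coupling B -> (forall x, irreducible_mx (B x)) ->
  torus_hamiltonian H -> bounded_sublevels H ->
  (forall i x p, - C0 <= H i x p) -> (forall i x, H i x 0 <= c) ->
  (forall x i, \sum_j B x i j = 0) ->
  exists K M, forall a : R, 0 < a -> exists c' w,
    [/\ viscosity_solution (fun x => B x + a%:M) H (fun=> c') w,
      forall i x z, w i z - w i x <= K * `|z - x|,
      forall i x, `|w i x| <= M & `|c'| <= M].
Proof.
move=> m0 BT Birr HT Hsub HC Hc hz; pose i0 : 'I_m := Ordinal m0.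
have cC : 0 <= c + C0.
  by have := Hc i0 0; have := HC i0 0 0; move: (H _ _ _); clear=> *; lra.
have [K K0 est] := nonneg_subsolution_estimates BT Birr Hsub HC cC.
pose M : R := 2 * K + `|c| + `|C0|.
have M2K : 2 * K <= M by rewrite /M -addrA lerDl addr_ge0.
have Mc : `|c| + `|C0| <= M by rewrite /M -addrA lerDr mulr_ge0.
exists K, M => a a0; have BaT := torus_couplingD (ltW a0) BT.
have [|v [vsol v0]] := solution_of_row_sum_gt0 (i0 := i0) (x0 := 0) BaT
  (fun x => irreducible_mxD a (Birr x)) HT Hsub HC Hc.
  by rewrite row_sumD hz add0r.
have [|_ _ _ av] := est a v (ltW a0); first by split=> //; exact: vsol.1.
have [i1 [x1 vmin]] := torus_min_family i0 vsol.1.1.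
pose mu := v i1 x1; pose w i x := v i x - mu.
have wsol : viscosity_solution (fun x => B x + a%:M) H (fun=> c - a * mu) w.
  by apply: viscosity_solution_shift => // x i; rewrite row_sumD hz add0r.
have w0 i x : 0 <= w i x by rewrite subr_ge0 vmin.
have amu0 : 0 <= a * mu by rewrite mulr_ge0 ?v0// ltW.
have wsub : nonneg_subsolution (fun x => B x + a%:M) H c w.
  split=> //; split=> [|i psi x psiC xmax]; first exact: wsol.1.1.
  by apply: (le_trans (wsol.1.2 i psi x psiC xmax)); rewrite gerBl.
have [wd wK _ _] := est a w (ltW a0) wsub.
exists (c - a * mu), w; split=> // [i x|].
  rewrite ger0_norm//; apply: (le_trans (torus_value_spread K0
    (fun i => (wsub.1.1 i).2) wd wK i i1 x x1)).
  by rewrite /w subrr add0r.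
apply: le_trans Mc; have := av i1 x1; rewrite -/mu.
have := ler_norm c; have := ler_norm (- c); rewrite normrN.
have := ler_norm C0; have := normr_ge0 C0; have := normr_ge0 c.
rewrite ler_norml; move: amu0; move: (a * mu) `|c| `|C0|.
by clear=> *; apply/andP; split; lra.
Qed.

(** With some positive row sum, any constant [c] above all [H i x 0] works
    directly. Otherwise the vanishing discount limit is taken. *)
Lemma ergodic_pair B H : (0 < m)%N ->
  torus_coupling B -> (forall x, irreducible_mx (B x)) ->
  torus_hamiltonian H -> bounded_sublevels H ->
  exists (c0 : R) v, (forall i, torus_lipschitz (v i)) /\
    viscosity_solution B H (fun=> c0) v.
Proof.
move=> m0 BT Birr HT Hsub; pose i0 : 'I_m := Ordinal m0.
have [C0 C00 HC] := bounded_below HT Hsub.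
have [c Hc] : exists c : R, forall i x, H i x 0 <= c.
  have [c cH] := torus_family_bounded (fun i => torus_hamiltonian_at i 0 HT).
  by exists c => i x; exact: le_trans (ler_norm _) (cH i x).
have [[x0 [i1 r0]]|hz] := pselect (exists x i, 0 < \sum_j B x i j).
  have cC : 0 <= c + C0.
    by have := Hc i0 0; have := HC i0 0 0; move: (H _ _ _); clear=> *; lra.
  have [K K0 est] := nonneg_subsolution_estimates BT Birr Hsub HC cC.
  have [v [vsol v0]] := solution_of_row_sum_gt0 BT Birr HT Hsub HC Hc r0.
  have B0 : (fun x => B x + 0%:M) = B by apply/funext => x; rewrite raddf0 addr0.
  have [|_ vK _ _] := est 0 v (lexx 0); first by rewrite B0; split=> //; exact: vsol.1.
  exists c, v; split=> // i; split; first exact: lipschitz_of_bound (vK i).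
  exact: (vsol.1.1 i).2.
have {}hz x i : \sum_j B x i j = 0.
  apply/eqP; rewrite eq_le (BT.2 x).2 andbT leNgt.
  by apply/negP => r0; apply: hz; exists x, i.
have [K [M disc]] := normalized_discounted_solution m0 BT Birr HT Hsub HC Hc hz.
pose a (k : nat) : R := k.+1%:R^-1.
have a0 k : 0 < a k by rewrite invr_gt0 ltr0Sn.
have /choice[f fP] : forall k, exists p : R * ('I_m -> 'rV[R]_n -> R),
    [/\ viscosity_solution (fun x => B x + (a k)%:M) H (fun=> p.1) p.2,
      forall i x z, p.2 i z - p.2 i x <= K * `|z - x|,
      forall i x, `|p.2 i x| <= M & `|p.1| <= M].
  by move=> k; have [c' [w wP]] := disc (a k) (a0 k); exists (c', w).
have [||||v [c0 [vp vK vlim]]] := @equilipschitz_limit R m n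
  (fun k => (f k).2) (fun k => (f k).1) K M.
- by move=> k i; have [s _ _ _] := fP k; exact: (s.1.1 i).2.
- by move=> k; have [] := fP k.
- by move=> k; have [] := fP k.
- by move=> k; have [] := fP k.
exists c0, v; split=> [i|]; first by split; [exact: lipschitz_of_bound (vK i)|].
apply: solution_stability => // [i|e e0].
  by split; [exact: oscillation_continuous (vK i) | exact: vp].
have M0 : 0 <= M by have [_ _ _] := fP 0%N; apply: le_trans.
have [k [Nk wv cv]] := vlim e (Num.bound (M / e)) e0.
exists (a k), (f k).1, (f k).2; have [sol _ wM _] := fP k; split=> // i x.
rewrite normrM (ger0_norm (ltW (a0 k))) mulrC.
apply: (@le_trans _ _ (M * a k)); first by rewrite ler_wpM2r// ltW.
rewrite ler_pdivrMr ?ltr0Sn// mulrC -ler_pdivrMr//.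
apply: ltW; apply: (lt_le_trans (archi_boundP _)); first by rewrite divr_ge0// ltW.
by rewrite ler_nat ltnW.
Qed.

End Ergodic.

Theorem theorem17 (R : realType) (m n : nat) (m_gt0 : (0 < m)%N)
    (n_gt0 : (0 < n)%N)
    (Xi : metricType R) (Xi_neq0 : [set: Xi] !=set0)
    (Xi_compact : compact [set: Xi])
    (g : 'I_m -> 'rV[R]_n * Xi -> 'rV[R]_n)
    (g_cont : forall i, torus_prod_continuous (g i))
    (L : 'I_m -> 'rV[R]_n * Xi -> R)
    (L_cont : forall i, torus_prod_continuous (L i))
    (B : 'rV[R]_n -> 'M[R]_m)
    (B_cont : forall i j, torus_continuous (fun x => B x i j))
    (H_coercive : coercive (hamiltonian g L))
    (B_monotone : forall x, monotone_mx (B x))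
    (B_irreducible : forall x, irreducible_mx (B x)) :
  exists (c0 : R) (v0 : 'I_m -> 'rV[R]_n -> R),
    (forall i, torus_lipschitz (v0 i)) /\
    viscosity_solution B (hamiltonian g L) (fun=> c0) v0.
Proof.
have HT := torus_hamiltonian_sup Xi_neq0 Xi_compact g_cont L_cont.
apply: ergodic_pair => //; last exact: coercive_bounded_sublevels.
by split=> // x; exact: monotone_m_matrix.
Qed.
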